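(* Suppose that $\Omega = [a,b]$ for $a < b$, and let $N \geq 1$ be an integer. If for every $\ell > 0$ there exists a unique optimal $N$-point kernel quadrature rule $Q_\ell^* = Q_{X_\ell^*}(w_\ell^* )$ for the Gaussian kernel $K_\ell$, then its points and weights converge to those of the $N$-point Gaussian quadrature rule for $L$: $$\lim_{\ell \to \infty} X_\ell^* = X_{\mathrm{G}} \quad \text{and} \quad \lim_{\ell \to \infty} w_\ell^* = w_{\mathrm{G}},$$ where $X_{\mathrm{G}}$ and $w_{\mathrm{G}}$ are the unique points and weights such that $Q_{X_{\mathrm{G}}}(w_{\mathrm{G}})[x^n] = L[x^n]$ for every $0 \leq n \leq 2N-1$. Moreover, $e_\ell(Q_\ell^* ) = \mathcal{O}(\ell^{-2N})$ as $\ell \to \infty$.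
   Context: $L \colon C([a,b]) \to \mathbb{R}$ is a positive linear functional ($L[f] \geq 0$ whenever $f \geq 0$) on the continuous real-valued functions on $\Omega=[a,b]$. The Gaussian kernel with length-scale $\ell>0$ is $K_\ell(x,x') = \exp(-(x-x')^2/(2\ell^2))$ on $\Omega \times \Omega$, and $\mathcal{H}(K_\ell) \subset C(\Omega)$ is its reproducing kernel Hilbert space. For points $X = (x_1,\ldots,x_N) \in \Omega^N$ and weights $w = (w(1),\ldots,w(N)) \in \mathbb{R}^N$, the quadrature rule is $Q_X(w)[f] = \sum_{n=1}^N w(n) f(x_n)$, and $Q_X(w)[x^n]$, $L[x^n]$ denote the values on the function $x \mapsto x^n$. The worst-case error is $e_\ell(Q_X(w)) = \sup_{\|f\|_{\mathcal{H}(K_\ell)} \leq 1} |L[f] - \sum_{n=1}^N w(n) f(x_n)|$. A kernel quadrature rule $Q_{X_\ell^*}(w_\ell^* )$ is optimal if $e_\ell(Q_{X_\ell^*}(w_\ell^* )) = \inf_{w \in \mathbb{R}^N,\, X \in \Omega^N} e_\ell(Q_X(w))$. To eliminate the freedom in ordering the points, all point sets are required to be in ascending order, $x_n \leq x_{n+1}$; uniqueness and convergence of points and weights are understood with this ordering. *)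

(* Defs.v *)
From HB Require Import structures.
From mathcomp Require Import all_boot all_order all_algebra.
From mathcomp Require Import all_classical all_reals all_analysis.

Set Implicit Arguments.
Unset Strict Implicit.
Unset Printing Implicit Defensive.

Import Order.TTheory GRing.Theory Num.Theory.
Import numFieldNormedType.Exports.

Local Open Scope classical_set_scope.
Local Open Scope ring_scope.

(* [set_type] carries the topology induced from R. *)
Notation Omega a b := (set_type `[a, b]%classic).

Section RKHS.
Variables (R : realType) (T : Type).

(* A real Hilbert space whose elements are functions on T, with the pointwise
   vector space structure; [inner] is only meaningful on [carrier]. *)
Record hilbertFunSpace := HilbertFunSpace {
  carrier : set (T -> R);
  inner : (T -> R) -> (T -> R) -> R;
  carrier0 : carrier 0;
  carrier_linear : forall (c : R) (f g : T -> R),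
    carrier f -> carrier g -> carrier (c *: f + g);
  inner_sym : forall f g : T -> R,
    carrier f -> carrier g -> inner f g = inner g f;
  inner_linear : forall (c : R) (f g h : T -> R),
    carrier f -> carrier g -> carrier h ->
    inner (c *: f + g) h = c * inner f h + inner g h;
  inner_ge0 : forall f : T -> R, carrier f -> 0 <= inner f f;
  inner_eq0 : forall f : T -> R, carrier f -> inner f f = 0 -> f = 0;
  carrier_complete : forall u : nat -> T -> R,
    (forall n, carrier (u n)) ->
    (forall eps : R, 0 < eps -> exists M : nat, forall m n : nat,
       (M <= m)%N -> (M <= n)%N ->
       Num.sqrt (inner (u m - u n) (u m - u n)) <= eps) ->
    exists2 f : T -> R, carrier f &
      Num.sqrt (inner (u n - f) (u n - f)) @[n --> \oo] --> 0 }.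

Definition hnorm (H : hilbertFunSpace) (f : T -> R) : R :=
  Num.sqrt (inner H f f).

(* By Moore-Aronszajn every positive semi-definite K has exactly one RKHS, as
   a set of functions together with the inner product on it. *)
Definition is_rkhs (K : T -> T -> R) (H : hilbertFunSpace) : Prop :=
  forall x : T, 
    carrier H (K ^~ x) /\
    (forall f : T -> R, carrier H f -> inner H f (K ^~ x) = f x).

End RKHS.

Section Quadrature.
Variables (R : realType) (a b : R).

Definition gauss_kernel (ell : R) (x y : Omega a b) : R :=
  expR (- (val x - val y) ^+ 2 / (2 * ell ^+ 2)).

(* A functional on C([a, b]) is represented by a function on all maps
   [a, b] -> R whose values at discontinuous maps are irrelevant. *)
Definition positive_linear_functional (L : (Omega a b -> R) -> R) : Prop :=
  (forall (c : R) (f g : Omega a b -> R), continuous f -> continuous g ->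
     L (c *: f + g) = c * L f + L g) /\
  (forall f : Omega a b -> R, continuous f -> (forall x, 0 <= f x) -> 0 <= L f).

Definition monomial (k : nat) (x : Omega a b) : R := val x ^+ k.

Section Rules.
Variable N : nat.

Definition quad (X : 'rV[Omega a b]_N) (w : 'rV[R]_N) (f : Omega a b -> R) : R :=
  \sum_(n < N) w ord0 n * f (X ord0 n).

Definition ascending (X : 'rV[Omega a b]_N) : Prop :=
  forall i j : 'I_N, (i <= j)%N -> val (X ord0 i) <= val (X ord0 j).

(* For the RKHS of a continuous kernel on [a, b] the errors over the unit ball
   are bounded, so the real-valued [sup] is the genuine supremum. *)
Definition worst_case_error (L : (Omega a b -> R) -> R)
    (H : hilbertFunSpace R (Omega a b))
    (X : 'rV[Omega a b]_N) (w : 'rV[R]_N) : R :=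
  sup [set `|L f - quad X w f| | f in [set f | carrier H f /\ hnorm H f <= 1]].

Definition optimal_rule (L : (Omega a b -> R) -> R)
    (H : hilbertFunSpace R (Omega a b))
    (X : 'rV[Omega a b]_N) (w : 'rV[R]_N) : Prop :=
  ascending X /\
  worst_case_error L H X w =
    inf (range (fun p : 'rV[Omega a b]_N * 'rV[R]_N =>
                  worst_case_error L H p.1 p.2)).

Definition gaussian_quadrature (L : (Omega a b -> R) -> R)
    (X : 'rV[Omega a b]_N) (w : 'rV[R]_N) : Prop :=
  ascending X /\
  forall k : nat, (k <= 2 * N - 1)%N -> quad X w (monomial k) = L (monomial k).

End Rules.

Definition is_the_unique_rule (N : nat)
    (P : 'rV[Omega a b]_N -> 'rV[R]_N -> Prop)
    (X : 'rV[Omega a b]_N) (w : 'rV[R]_N) : Prop :=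
  P X w /\ forall X' w', P X' w' -> X' = X /\ w' = w.

End Quadrature.

(* Main.v *)
Require Import Defs.
From HB Require Import structures.
From mathcomp Require Import all_boot all_order all_algebra.
From mathcomp Require Import all_classical all_reals all_analysis.
From mathcomp Require Import ring lra zify.

Import Order.TTheory GRing.Theory Num.Theory.
Import numFieldNormedType.Exports.

Local Open Scope classical_set_scope.
Local Open Scope ring_scope.

(** The errors are computed through discrete measures: L is approximated by finite combinations
    of point evaluations L_n, and mu = L_n - Q has a representer in the RKHS whose squared norm
    is the energy (mu x mu) K.

    Lower bound.  As K(x,y) = sum_k f_k(x) f_k(y) / (k! ell^(2k)) with
    f_k(x) = x^k exp(-x^2 / (2 ell^2)), the energy of mu dominates mu(f_k)^2 / (k! ell^(2k)), so
    |L f_k - Q f_k| <= k! ell^k e(Q).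

    Upper bound.  If Q is exact up to degree 2N - 1, then L - Q annihilates in one of the two
    variables every monomial of total degree < 4N, hence the Taylor polynomial of K of order 2N
    in (x-y)^2 / (2 ell^2); the remainder is O(ell^(-4N)), so e(Q) = O(ell^(-2N)).

    Combining both, the optimal weights multiplied by exp(-x_n^2 / (2 ell^2)) integrate x^k to
    L(x^k) + o(1) for k < 2N.  With p the monic polynomial vanishing at the optimal nodes and
    p_G that of the Gauss nodes, orthogonality yields L((p - p_G)^2) -> 0; by Gauss quadrature
    this is sum_i w_i p(x_i)^2 over the Gauss nodes, so some optimal node tends to each x_i.
    The Gauss nodes themselves minimise L(prod (x - x_i)^2) over [a,b]^N, and uniqueness of the
    optimal rule excludes that L is supported on fewer than N points. *)

(** * Reproducing kernel Hilbert spaces and discrete measures *)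

Section InnerProduct.
Context {R : realType} {T : Type} (H : hilbertFunSpace R T).
Implicit Types (f g h : T -> R) (c : R).

Lemma carrierZ c f : carrier H f -> carrier H (c *: f).
Proof. by move=> Hf; rewrite -[_ *: _]addr0; apply: carrier_linear => //; exact: carrier0. Qed.

Lemma carrierD f g : carrier H f -> carrier H g -> carrier H (f + g).
Proof. by move=> Hf Hg; rewrite -[f]scale1r; exact: carrier_linear. Qed.

Lemma innerD f g h : carrier H f -> carrier H g -> carrier H h ->
  inner H (f + g) h = inner H f h + inner H g h.
Proof. by move=> Hf Hg Hh; rewrite -{1}[f]scale1r inner_linear// mul1r. Qed.

Lemma inner0 h : carrier H h -> inner H 0 h = 0.
Proof.
move=> Hh; have H0 := carrier0 H.
by have := innerD _ _ _ H0 H0 Hh; rewrite addr0 => /eqP; rewrite -subr_eq subrr => /eqP.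
Qed.

Lemma innerZ c f h : carrier H f -> carrier H h -> inner H (c *: f) h = c * inner H f h.
Proof.
move=> Hf Hh; rewrite -{1}[c *: f]addr0 inner_linear//; last exact: carrier0.
by rewrite inner0// addr0.
Qed.

(** The squared norm of t f + g is a nonnegative quadratic in t; its value at the minimum point t =
    - <f, g> / <f, f> gives the inequality. When <f, f> = 0, f itself vanishes. *)
Lemma inner_CauchySchwarz f g : carrier H f -> carrier H g ->
  inner H f g ^+ 2 <= inner H f f * inner H g g.
Proof.
move=> Hf Hg; have [f0|fn0] := eqVneq (inner H f f) 0.
  by rewrite (inner_eq0 Hf f0) !inner0 ?expr0n ?mul0r//; exact: carrier0.
have f_gt0 : 0 < inner H f f by rewrite lt_def fn0 inner_ge0.
have sub t : 0 <= t ^+ 2 * inner H f f + 2 * t * inner H f g + inner H g g.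
  have Ht := carrierZ t _ Hf; have Htg := carrierD _ _ Ht Hg.
  have := inner_ge0 Htg; rewrite innerD// innerZ// inner_sym// innerD// innerZ//.
  rewrite [inner H g (_ + _)]inner_sym// innerD// innerZ//.
  by rewrite [inner H g f]inner_sym// => /le_trans; apply; rewrite le_eqVlt; apply/orP; left;
    apply/eqP; ring.
have := sub (- inner H f g / inner H f f).
have -> : (- inner H f g / inner H f f) ^+ 2 * inner H f f +
   2 * (- inner H f g / inner H f f) * inner H f g + inner H g g =
   (inner H f f * inner H g g - inner H f g ^+ 2) / inner H f f by field.
by rewrite pmulr_lge0 ?invr_gt0// subr_ge0.
Qed.

End InnerProduct.

(* A list of pairs (c, x) stands for the discrete signed measure \sum c * \delta_x. *)
Definition dmeas {R : realType} {T : Type} (s : seq (R * T)) (f : T -> R) : R :=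
  \sum_(p <- s) p.1 * f p.2.

(** Repeated points are not merged, so this is an upper bound for the total variation. *)
Definition dmass {R : realType} {T : Type} (s : seq (R * T)) : R := \sum_(p <- s) `|p.1|.

Section DiscreteMeasure.
Context {R : realType} {T : Type}.
Implicit Types (s : seq (R * T)) (f g : T -> R).

Lemma dmeas_cat s1 s2 f : dmeas (s1 ++ s2) f = dmeas s1 f + dmeas s2 f.
Proof. by rewrite /dmeas big_cat. Qed.

Lemma dmass_cat s1 s2 : dmass (s1 ++ s2) = dmass s1 + dmass s2.
Proof. by rewrite /dmass big_cat. Qed.

Lemma dmeasD s f g : dmeas s (fun x => f x + g x) = dmeas s f + dmeas s g.
Proof. by rewrite /dmeas -big_split/=; apply: eq_bigr => p _; rewrite mulrDr. Qed.

Lemma dmeasM s c f : dmeas s (fun x => c * f x) = c * dmeas s f.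
Proof. by rewrite /dmeas mulr_sumr; apply: eq_bigr => p _; rewrite mulrCA. Qed.

Lemma dmeas_sum s (I : Type) (r : seq I) (F : I -> T -> R) :
  dmeas s (fun x => \sum_(i <- r) F i x) = \sum_(i <- r) dmeas s (F i).
Proof.
rewrite /dmeas exchange_big/=; apply: eq_bigr => p _; by rewrite mulr_sumr.
Qed.

Lemma le_dmeas s f C : (forall x, `|f x| <= C) -> `|dmeas s f| <= dmass s * C.
Proof.
move=> fC; apply: (le_trans (ler_norm_sum _ _ _)); rewrite /dmass mulr_suml.
by apply: ler_sum => p _; rewrite normrM ler_wpM2l.
Qed.

End DiscreteMeasure.

Section Reproducing.
Context {R : realType} {T : Type} {K : T -> T -> R} {H : hilbertFunSpace R T}.
Hypothesis KH : is_rkhs K H.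
Implicit Types (s : seq (R * T)) (f : T -> R).

Definition representer s : T -> R := \sum_(p <- s) p.1 *: K ^~ p.2.

Lemma representerE s x : representer s x = dmeas s (K x).
Proof. by rewrite /representer /dmeas fct_sumE. Qed.

Lemma representer_carrier s : carrier H (representer s).
Proof.
rewrite /representer; elim: s => [|p s IH]; first by rewrite big_nil; exact: carrier0.
by rewrite big_cons; apply: carrier_linear => //; case: (KH p.2).
Qed.

Lemma inner_representer f s : carrier H f -> inner H f (representer s) = dmeas s f.
Proof.
move=> Hf; rewrite inner_sym//; last exact: representer_carrier.
elim: s => [|p s IH]; first by rewrite /representer /dmeas !big_nil inner0.
have [Kp /(_ f Hf) Hp] := KH p.2.
have Hs := representer_carrier s.
rewrite /representer /dmeas !big_cons inner_linear//.
by rewrite [in X in _ * X]inner_sym// Hp; congr (_ + _).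
Qed.

Lemma hnorm_representer s :
  inner H (representer s) (representer s) = dmeas s (fun x => dmeas s (K x)).
Proof.
rewrite inner_representer; last exact: representer_carrier.
by apply: eq_bigr => p _; rewrite representerE.
Qed.

Lemma energy_ge0 s : 0 <= dmeas s (fun x => dmeas s (K x)).
Proof. by rewrite -hnorm_representer inner_ge0//; exact: representer_carrier. Qed.

(** Cauchy-Schwarz against the representer of [s]. One or two point masses give bounds on the values
    and increments of [f]; the measure [quad_defect] gives the quadrature error. *)
Lemma dmeas_le_energy s f : carrier H f ->
  dmeas s f ^+ 2 <= inner H f f * dmeas s (fun x => dmeas s (K x)).
Proof.
move=> Hf; rewrite -inner_representer// -hnorm_representer.
by apply: inner_CauchySchwarz => //; exact: representer_carrier.
Qed.

Lemma sqr_hnorm f : carrier H f -> hnorm H f ^+ 2 = inner H f f.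
Proof. by move=> Hf; rewrite /hnorm sqr_sqrtr// inner_ge0. Qed.

End Reproducing.

(** * Positive functionals on C([a, b]) *)

Lemma cvg_sumr {R : realType} {T : Type} {F : set_system T} {FF : Filter F}
    (I : Type) (r : seq I) (f : I -> T -> R) (l : I -> R) :
  (forall i, f i x @[x --> F] --> l i) ->
  (\sum_(i <- r) f i x) @[x --> F] --> \sum_(i <- r) l i.
Proof.
move=> fl; elim: r => [|i r IH].
  by under eq_fun do rewrite big_nil; rewrite big_nil; exact: cvg_cst.
under eq_fun do rewrite big_cons; rewrite big_cons; exact: cvgD (fl i) IH.
Qed.

Section Functional.
Context {R : realType} {a b : R} {L : (Omega a b -> R) -> R}.
Hypotheses (ab : a < b) (Lpos : positive_linear_functional L).
Implicit Types (f g : Omega a b -> R) (x y : Omega a b).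

Lemma omega_itv x : a <= val x <= b.
Proof. by have := set_valP x; rewrite /= in_itv. Qed.

Lemma mem_omega (z : R) : a <= z <= b -> z \in `[a, b]%classic.
Proof. by move=> zab; rewrite inE /= in_itv. Qed.

Definition omega_left : Omega a b := SigSub (mem_omega _ (introT andP (conj (lexx a) (ltW ab)))).

Lemma omega_leftE : val omega_left = a. Proof. by []. Qed.

Definition omega (z : R) : Omega a b := insubd omega_left z.

Lemma omegaK z : a <= z <= b -> val (omega z) = z.
Proof. by move=> zab; rewrite /omega insubdK//; exact: mem_omega. Qed.

(** All integrands below (polynomials, kernel features, elements of the RKHS) are Lipschitz. This
    yields continuity and also an explicit discretization error for [L]. *)
Definition lip (M : R) f := forall x y, `|f x - f y| <= M * `|val x - val y|.

Lemma lip_continuous M f : lip M f -> continuous f.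
Proof.
move=> fM x; have FF := nbhs_filter x; apply/cvgrPdist_lt => e e0.
have M0 : 0 < `|M| + 1 by rewrite ltr_pwDr.
have : (val : Omega a b -> R) y @[y --> x] --> val x by exact: initial_continuous.
move/cvgrPdist_lt => /(_ (e / (`|M| + 1))); rewrite divr_gt0// => /(_ isT).
apply: filterS => y; rewrite ltr_pdivlMr//; apply: le_lt_trans.
apply: (le_trans (fM x y)).
rewrite mulrC ler_wpM2l//; apply: (le_trans (ler_norm M)); by rewrite lerDl.
Qed.

Lemma lipD M M' f g : lip M f -> lip M' g -> lip (M + M') (fun x => f x + g x).
Proof.
move=> fM gM x y; rewrite opprD addrACA mulrDl.
by apply: (le_trans (ler_normD _ _)); exact: lerD.
Qed.

Lemma lip_cst c : lip 0 (fun=> c).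
Proof. by move=> x y; rewrite subrr normr0 mul0r. Qed.

Lemma lipZ M f c : lip M f -> lip (`|c| * M) (fun x => c * f x).
Proof. by move=> fM x y; rewrite -mulrBr normrM -mulrA ler_wpM2l. Qed.

Lemma lipM M M' C C' f g : lip M f -> lip M' g ->
  (forall x, `|f x| <= C) -> (forall x, `|g x| <= C') ->
  lip (M * C' + C * M') (fun x => f x * g x).
Proof.
move=> fM gM fC gC x y.
have -> : f x * g x - f y * g y = (f x - f y) * g x + f y * (g x - g y) by ring.
apply: (le_trans (ler_normD _ _)); rewrite !normrM mulrDl; apply: lerD.
  by rewrite mulrAC ler_pM.
by rewrite -mulrA ler_pM.
Qed.

Lemma lip_bounded M f : lip M f -> exists2 C, 0 <= C & forall x, `|f x| <= C.
Proof.
move=> fM; exists (`|f omega_left| + `|M| * (b - a)).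
  by rewrite addr_ge0// mulr_ge0// subr_ge0 ltW.
move=> x; rewrite -[f x](subrK (f omega_left)) addrC.
apply: (le_trans (ler_normD _ _)); rewrite lerD2l.
apply: (le_trans (fM _ _)).
apply: (@le_trans _ _ (`|M| * `|val x - val omega_left|)).
  by rewrite ler_wpM2r// ler_norm.
have /andP[ax xb] := omega_itv x; rewrite ler_wpM2l// omega_leftE ger0_norm; lra.
Qed.

Lemma lip_cont f : (exists M, lip M f) -> continuous f.
Proof. by case=> M; exact: lip_continuous. Qed.

Lemma ex_lipM f g : (exists M, lip M f) -> (exists M, lip M g) ->
  exists M, lip M (fun x => f x * g x).
Proof.
case=> M fM [M' gM]; have [C _ fC] := lip_bounded _ _ fM.
by have [C' _ gC] := lip_bounded _ _ gM; exists (M * C' + C * M'); exact: lipM.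
Qed.

Lemma lip_val : lip 1 val.
Proof. by move=> x y; rewrite mul1r. Qed.

Lemma ex_lip_monomial k : exists M, lip M (monomial k : Omega a b -> R).
Proof.
elim: k => [|k [M IH]].
  by exists 0 => x y; rewrite /monomial !expr0 subrr normr0 mul0r.
have [||M' hM'] := ex_lipM val (monomial k).
- by exists 1; exact: lip_val.
- by exists M.
- by exists M' => x y; have := hM' x y; rewrite /monomial !exprS.
Qed.

Lemma ex_lip_horner (p : {poly R}) : exists M, lip M (fun x : Omega a b => p.[val x]).
Proof.
elim/poly_ind: p => [|p c [M IH]].
  by exists 0 => x y; rewrite !horner0 subrr normr0 mul0r.
have [||M' hM'] := ex_lipM (fun x => p.[val x]) val.
- by exists M.
- by exists 1; exact: lip_val.
- by exists (M' + 0) => x y; rewrite !hornerMXaddC; exact: lipD hM' (lip_cst c) x y.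
Qed.

Definition tmass := L (fun=> 1).

Lemma cont_cst c : continuous ((fun=> c) : Omega a b -> R).
Proof. exact: cst_continuous. Qed.

Lemma functD f g : continuous f -> continuous g -> L (fun x => f x + g x) = L f + L g.
Proof.
move=> cf cg; rewrite -[L f]mul1r -(proj1 Lpos)//; congr L.
by rewrite scale1r.
Qed.

Lemma funct0 : L (fun=> 0) = 0.
Proof.
have := functD _ _ (cont_cst 0) (cont_cst 0).
have -> : (fun x : Omega a b => 0 + 0) = (fun=> 0) :> (_ -> R).
  by apply/funext => x; rewrite addr0.
by move/eqP; rewrite -subr_eq subrr => /eqP.
Qed.

Lemma functZ c f : continuous f -> L (fun x => c * f x) = c * L f.
Proof.
move=> cf; rewrite -[RHS]addr0 -funct0 -(proj1 Lpos)//; last exact: cont_cst.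
by congr L; apply/funext => x; rewrite fctE addr0.
Qed.

Lemma contZ c f : continuous f -> continuous (fun x => c * f x).
Proof.
move=> cf x; have FF := nbhs_filter x.
by apply: (@cvgM _ _ _ FF); [exact: cvg_cst|exact: cf].
Qed.

Lemma contB f g : continuous f -> continuous g -> continuous (fun x => f x - g x).
Proof.
move=> cf cg x; have FF := nbhs_filter x.
by apply: (@cvgB _ _ _ _ FF); [exact: cf|exact: cg].
Qed.

Lemma functB f g : continuous f -> continuous g -> L (fun x => f x - g x) = L f - L g.
Proof.
move=> cf cg; have := functD f (fun x => -1 * g x) cf (contZ _ _ cg).
rewrite functZ// mulN1r => <-; congr L; by apply/funext => x; rewrite mulN1r.
Qed.

Lemma cont_sum (I : Type) (r : seq I) (F : I -> Omega a b -> R) :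
  (forall i, continuous (F i)) -> continuous (fun x => \sum_(i <- r) F i x).
Proof.
by move=> cF x; apply: (@cvg_sumr _ _ _ (nbhs_filter x)) => i; exact: cF.
Qed.

Lemma funct_sum (I : Type) (r : seq I) (F : I -> Omega a b -> R) :
  (forall i, continuous (F i)) ->
  L (fun x => \sum_(i <- r) F i x) = \sum_(i <- r) L (F i).
Proof.
move=> cF; elim: r => [|i r IH].
  rewrite big_nil -[RHS]funct0; congr L; by apply/funext => x; rewrite big_nil.
rewrite big_cons -IH -functD//; last exact: cont_sum.
by congr L; apply/funext => x; rewrite big_cons.
Qed.

Lemma le_funct f g : continuous f -> continuous g -> (forall x, f x <= g x) -> L f <= L g.
Proof.
move=> cf cg fg; rewrite -subr_ge0 -functB//; apply: (proj2 Lpos) => [|x].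
  exact: contB.
by rewrite subr_ge0.
Qed.

Lemma tmass_ge0 : 0 <= tmass.
Proof. by apply: (proj2 Lpos) => [|x]; [exact: cont_cst|exact: ler01]. Qed.

Lemma norm_funct_le f C : continuous f -> (forall x, `|f x| <= C) -> `|L f| <= C * tmass.
Proof.
move=> cf fC; rewrite ler_norml -mulNr /tmass -!functZ; do ?exact: cont_cst.
by apply/andP; split; apply: le_funct => //; do ?[exact: cont_cst] => x; rewrite mulr1;
  have := fC x; rewrite ler_norml => /andP[].
Qed.

Definition clamp (z : R) : R := Num.min 1 (Num.max 0 z).

Lemma clampE z :
  [\/ z <= 0 /\ clamp z = 0, [/\ 0 <= z, z <= 1 & clamp z = z] | 1 <= z /\ clamp z = 1].
Proof.
rewrite /clamp; have [z0|z0] := leP z 0.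
  by apply: Or31; split => //; rewrite min_r.
have [z1|z1] := leP z 1; first by apply: Or32; split => //; exact: ltW.
by apply: Or33; split => //; exact: ltW.
Qed.

Lemma clamp_le z t : z <= t -> clamp z <= clamp t.
Proof. by move=> zt; case: (clampE z) => -[? *]; case: (clampE t) => -[? *]; lra. Qed.

Lemma clamp_lip z t : `|clamp z - clamp t| <= `|z - t|.
Proof.
rewrite ler_norml; have := normr_ge0 (z - t).
have /andP[h1 h2] : - `|z - t| <= z - t <= `|z - t| by rewrite -ler_norml.
move=> h0; case: (clampE z) => -[? *]; case: (clampE t) => -[? *];
  by apply/andP; split; lra.
Qed.

Lemma clamp_ge1 z : 1 <= z -> clamp z = 1.
Proof. by case: (clampE z) => -[? *]; lra. Qed.

Lemma clamp_le0 z : z <= 0 -> clamp z = 0.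
Proof. by case: (clampE z) => -[? *]; lra. Qed.

(** * Discretization of a positive functional by hat functions *)

Section Hats.
Variable n : nat.
Let d : R := (b - a) / n.+1%:R.

Let d_gt0 : 0 < d. Proof. by rewrite /d divr_gt0// subr_gt0. Qed.

Let ramp (j : nat) (x : Omega a b) : R := clamp ((val x - a) / d - j%:R + 1).

(* As differences of consecutive ramps, the hats sum to 1 by telescoping. *)
Definition hat (j : nat) (x : Omega a b) : R := ramp j x - ramp j.+1 x.

Let node (j : nat) : Omega a b := omega (a + j%:R * d).

Let node_val j : (j < n.+2)%N -> val (node j) = a + j%:R * d.
Proof.
move=> jn; rewrite omegaK//.
have : j%:R * d <= b - a.
  have -> : b - a = n.+1%:R * d by rewrite /d mulrCA divff ?mulr1 ?pnatr_eq0.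
  by rewrite ler_pM2r// ler_nat.
have : 0 <= j%:R * d by rewrite mulr_ge0// ltW.
by move=> ? ?; apply/andP; split; lra.
Qed.

Let hat_ge0 j x : 0 <= hat j x.
Proof. by rewrite subr_ge0 clamp_le// -natr1; lra. Qed.

Let hat_supp j x : (j < n.+2)%N -> hat j x != 0 -> `|val x - val (node j)| <= d.
Proof.
move=> jn h; rewrite node_val//.
have -> : val x - (a + j%:R * d) = ((val x - a) / d - j%:R) * d.
  by field; rewrite gt_eqF.
rewrite normrM (gtr0_norm d_gt0) ger_pMl// leNgt; apply: contra_neqN h.
rewrite /hat /ramp -natr1 lter_normr => /orP[h|h].
  by rewrite !clamp_ge1 ?subrr//; lra.
by rewrite !clamp_le0 ?subrr//; lra.
Qed.

Let sum_hat x : \sum_(j <- iota 0 n.+2) hat j x = 1.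
Proof.
have /andP[ax xb] := omega_itv x.
have -> : \sum_(j <- iota 0 n.+2) hat j x = - \sum_(0 <= j < n.+2) (ramp j.+1 x - ramp j x).
  by rewrite -sumrN /index_iota subn0; apply: eq_bigr => j _; rewrite opprB.
rewrite telescope_sumr// opprB /ramp clamp_ge1 ?clamp_le0 ?subr0//.
  rewrite -(natr1 n.+1); suff : (val x - a) / d <= n.+1%:R by lra.
  rewrite ler_pdivrMr// /d mulrCA divff ?mulr1 ?pnatr_eq0//; lra.
by rewrite lerDr divr_ge0 ?(ltW d_gt0)//; lra.
Qed.

Let hat_lip j : lip (2 / d) (hat j).
Proof.
move=> x y; rewrite /hat.
have -> : ramp j x - ramp j.+1 x - (ramp j y - ramp j.+1 y) =
  (ramp j x - ramp j y) + (ramp j.+1 y - ramp j.+1 x) by ring.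
apply: (le_trans (ler_normD _ _)).
rewrite mulrC mulrA (_ : _ * 2 / d = `|val x - val y| / d + `|val x - val y| / d); last first.
  by field; rewrite gt_eqF.
have q c : `|((val x - a) / d - c + 1) - ((val y - a) / d - c + 1)| = `|val x - val y| / d.
  rewrite (_ : _ + 1 - _ = (val x - val y) / d); last by field; rewrite gt_eqF.
  by rewrite normrM normfV (gtr0_norm d_gt0).
apply: lerD; first by rewrite -(q j%:R) clamp_lip.
by rewrite -(q j.+1%:R) distrC clamp_lip.
Qed.

(** As a functional this is [L] applied to the piecewise linear interpolant at the n + 2 equispaced
    nodes from a to b. Its weights are nonnegative and, the hats being a partition of unity, have
    the same sum L(1) for all n. *)
Definition discretization : seq (R * Omega a b) :=
  [seq (L (hat j), node j) | j <- iota 0 n.+2].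

Let hat_cont j : continuous (hat j).
Proof. exact: lip_continuous (hat_lip j). Qed.

Lemma dmass_discretization : dmass discretization = tmass.
Proof.
rewrite /dmass big_map /=.
have -> : tmass = L (fun x => \sum_(j <- iota 0 n.+2) hat j x).
  by congr L; apply/funext => x; rewrite sum_hat.
rewrite funct_sum//; apply: eq_bigr => j _; rewrite ger0_norm//.
exact: (proj2 Lpos).
Qed.

(** Since the hats sum to 1, f minus its interpolant is the sum of (f - f(node j)) [hat j], and
    [hat j] lives within distance d of its node, where the first factor is at most M d. *)
Lemma discretization_error M f : 0 <= M -> lip M f ->
  `|L f - dmeas discretization f| <= M * d * tmass.
Proof.
move=> M0 fM; have cf := lip_continuous _ _ fM.
rewrite /dmeas big_map /=.
under eq_bigr => j _ do rewrite mulrC -functZ//.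
rewrite -funct_sum; last by move=> j; exact: contZ.
rewrite -functB//; last by apply: cont_sum => j; exact: contZ.
apply: norm_funct_le => [|x].
  by apply: contB => //; apply: cont_sum => j; exact: contZ.
have -> : f x - \sum_(j <- iota 0 n.+2) f (node j) * hat j x =
   \sum_(j <- iota 0 n.+2) (f x - f (node j)) * hat j x.
  rewrite -[X in X - _]mulr1 -(sum_hat x) mulr_sumr -sumrB.
  by apply: eq_bigr => j _; rewrite mulrBl.
apply: (le_trans (ler_norm_sum _ _ _)).
rewrite -[leRHS]mulr1 -(sum_hat x) mulr_sumr big_seq [leRHS]big_seq.
apply: ler_sum => j; rewrite mem_iota => /andP[_ jn].
rewrite normrM (ger0_norm (hat_ge0 j x)).
have [->|h0] := eqVneq (hat j x) 0; first by rewrite !mulr0.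
rewrite ler_wpM2r//; apply: (le_trans (fM _ _)); rewrite ler_wpM2l//.
exact: hat_supp.
Qed.

End Hats.

Lemma discretization_cvg f : (exists M, lip M f) ->
  dmeas (discretization n) f @[n --> \oo] --> L f.
Proof.
case=> M fM.
have fM' : lip `|M| f.
  by move=> x y; apply: (le_trans (fM x y)); rewrite ler_wpM2r// ler_norm.
apply/cvgrPdist_le => e e0.
have : `|M| * (b - a) * tmass * n.+1%:R^-1 @[n --> \oo] --> (0 : R).
  rewrite -[X in _ --> X](mulr0 (`|M| * (b - a) * tmass)).
  by apply: cvgM; [exact: cvg_cst|exact: cvg_harmonic].
move/cvgrPdist_le => /(_ e e0); apply: filterS => n; rewrite sub0r normrN => h.
apply: (le_trans (discretization_error n _ _ (normr_ge0 M) fM')).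
apply: (le_trans _ h); apply: (le_trans _ (ler_norm _)).
by rewrite le_eqVlt; apply/orP; left; apply/eqP; ring.
Qed.

End Functional.

Arguments tmass {R a b} L.
Arguments discretization {R a b} L ab n.

(** * The Gaussian kernel and worst-case errors *)

Section ExpBounds.
Context {R : realType}.
Implicit Types t u v : R.

(** For u <= v the difference is e^(-u) (1 - e^(-(v-u))), with e^(-u) <= 1 and 1 - e^(-s) <= s. *)
Lemma expRN_lip u v : 0 <= u -> 0 <= v -> `|expR (- u) - expR (- v)| <= `|u - v|.
Proof.
wlog uv : u v / u <= v => [hw u0 v0|u0 v0].
  have /orP[uv|vu] := le_total u v; first exact: hw.
  by rewrite distrC (distrC u); exact: hw.
rewrite [`|u - v|]distrC !ger0_norm ?subr_ge0 ?ler_expR ?lerN2//.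
have -> : - v = - u + - (v - u) by ring.
rewrite expRD -{1}[expR (- u)]mulr1 -mulrBr.
have h := expR_ge1Dx (- (v - u)).
apply: (@le_trans _ _ (1 - expR (- (v - u)))); last lra.
apply: ler_piMl; last by rewrite -expR0 ler_expR; lra.
by rewrite subr_ge0 -expR0 ler_expR; lra.
Qed.

Lemma series_exp_coeff_le t n : 0 <= t -> series (exp_coeff t) n <= expR t.
Proof.
move=> t0; apply: (@nondecreasing_cvgn_le _ (series (exp_coeff t))).
  apply/nondecreasing_seqP => k; rewrite seriesSr lerDl.
  by rewrite /exp_coeff divr_ge0 ?exprn_ge0.
exact: is_cvg_series_exp_coeff.
Qed.

Lemma cvg_series_exp t : series (exp_coeff t) n @[n --> \oo] --> expR t.
Proof. exact: is_cvg_series_exp_coeff. Qed.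

(** Termwise, (n+i)! >= i! allows t^n to be pulled out of the tail, leaving a partial sum of e^t. A
    factor 1/n! is given up, as only the order t^n matters. *)
Lemma expRN_taylor t n : 0 <= t ->
  `|expR (- t) - series (exp_coeff (- t)) n| <= t ^+ n * expR t.
Proof.
move=> t0.
have tail p : `|series (exp_coeff (- t)) (p + n)%N - series (exp_coeff (- t)) n|
    <= t ^+ n * expR t.
  rewrite series_addn addrC addKr.
  apply: (le_trans (ler_norm_sum _ _ _)).
  rewrite -{1}[n]add0n big_addn addnK.
  apply: (@le_trans _ _ (t ^+ n * series (exp_coeff t) p)); last first.
    by rewrite ler_wpM2l ?exprn_ge0 ?series_exp_coeff_le.
  rewrite seriesEnat mulr_sumr; apply: ler_sum => i _.
  rewrite /exp_coeff normrM normrX normrN (ger0_norm t0) addnC exprD -mulrA.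
  rewrite ler_wpM2l ?exprn_ge0// ler_wpM2l ?exprn_ge0//.
  rewrite ger0_norm// lef_pV2 ?posrE ?ltr0n ?fact_gt0// ler_nat.
  by elim: n => // k IH; rewrite addSn factS (leq_trans IH)// leq_pmull.
have c1 : series (exp_coeff (- t)) (p + n)%N @[p --> \oo] --> expR (- t).
  by rewrite (cvg_shiftn n); exact: cvg_series_exp.
apply: (cvgr_to_le (cvg_norm (cvgB c1 (cvg_cst _)))).
by apply: nearW => p; exact: tail.
Qed.

End ExpBounds.

Section GaussKernel.
Context {R : realType} {a b : R}.
Hypothesis ab : a < b.
Implicit Types (x y : Omega a b) (s : seq (R * Omega a b)).

Definition kfeature (ell : R) (k : nat) x : R :=
  val x ^+ k * expR (- (val x ^+ 2 / (2 * ell ^+ 2))).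

Lemma ex_lip_kfeature ell k : exists M, lip M (kfeature ell k).
Proof.
apply: (ex_lipM ab _ _ (ex_lip_monomial ab k)).
have [M hM] := ex_lipM ab _ _ (ex_lip_monomial ab 1) (ex_lip_monomial ab 1).
exists (`|(2 * ell ^+ 2)^-1| * M) => x y.
apply: le_trans (lipZ _ _ (2 * ell ^+ 2)^-1 hM x y).
rewrite /monomial !expr1 -!expr2 ![_^-1 * _]mulrC; apply: expRN_lip.
  by rewrite divr_ge0 ?sqr_ge0// mulr_ge0// sqr_ge0.
by rewrite divr_ge0 ?sqr_ge0// mulr_ge0// sqr_ge0.
Qed.

Lemma gauss_kernel_expand ell x y : 0 < ell ->
  gauss_kernel ell x y = kfeature ell 0 x * kfeature ell 0 y * expR (val x * val y / ell ^+ 2).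
Proof.
move=> l0; rewrite /kfeature !expr0 !mul1r -!expRD /gauss_kernel; congr expR.
by field; rewrite gt_eqF.
Qed.

(** Expanding exp(x y / ell^2) writes the energy as a series of nonnegative squares, from which only
    the k-th is kept. *)
Lemma energy_ge_kfeature ell s k : 0 < ell ->
  dmeas s (kfeature ell k) ^+ 2 <=
  k`!%:R * ell ^+ (2 * k) * dmeas s (fun x => dmeas s (gauss_kernel ell x)).
Proof.
move=> l0; set c := fun m : nat => (m`!%:R * ell ^+ (2 * m))^-1.
have c0 m : 0 < c m by rewrite invr_gt0 mulr_gt0 ?exprn_gt0 ?ltr0n ?fact_gt0.
pose S n := \sum_(0 <= m < n) c m * dmeas s (kfeature ell m) ^+ 2.
(* The partial sum [S n] is the energy for the kernel whose factor exp(x y / ell^2) is cut after n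
   terms. *)
have SE n : S n = dmeas s (fun x => dmeas s (fun y =>
    kfeature ell 0 x * kfeature ell 0 y * series (exp_coeff (val x * val y / ell ^+ 2)) n)).
  transitivity (\sum_(0 <= m < n) dmeas s (fun x => dmeas s (fun y =>
      kfeature ell 0 x * kfeature ell 0 y * exp_coeff (val x * val y / ell ^+ 2) m))).
    apply: eq_bigr => m _; rewrite expr2 mulrA -dmeasM.
    congr dmeas; apply/funext => x; rewrite mulrAC -dmeasM.
    congr dmeas; apply/funext => y.
    have -> : exp_coeff (val x * val y / ell ^+ 2) m =
      (val x * val y / ell ^+ 2) ^+ m / m`!%:R by [].
    rewrite /kfeature /c !expr0 !mul1r exprMn exprVn exprMn exprM.
    by field; rewrite pnatr_eq0 -lt0n fact_gt0 !expf_neq0// gt_eqF.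
  symmetry; rewrite -[RHS](dmeas_sum s _ (index_iota 0 n)); congr dmeas; apply/funext => x.
  rewrite -[RHS](dmeas_sum s _ (index_iota 0 n)); congr dmeas; apply/funext => y.
  by rewrite seriesEnat mulr_sumr.
have cS : S n @[n --> \oo] --> dmeas s (fun x => dmeas s (gauss_kernel ell x)).
  under eq_fun do rewrite SE; rewrite /dmeas.
  apply: cvg_sumr => p; apply: cvgM; first exact: cvg_cst.
  apply: cvg_sumr => q; apply: cvgM; first exact: cvg_cst.
  rewrite gauss_kernel_expand//.
  by apply: cvgM; [exact: cvg_cst|exact: cvg_series_exp].
have : c k * dmeas s (kfeature ell k) ^+ 2 <= dmeas s (fun x => dmeas s (gauss_kernel ell x)).
  apply: (cvgr_to_ge cS); exists k.+1 => //= n kn.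
  rewrite /S (@big_cat_nat _ _ _ k.+1)//= big_nat_recr//= -addrA addrCA lerDl.
  by rewrite addr_ge0// sumr_ge0// => i _; rewrite mulr_ge0 ?sqr_ge0// ltW.
rewrite mulrC /c ler_pdivrMr ?mulr_gt0 ?exprn_gt0 ?ltr0n ?fact_gt0//.
by rewrite mulrC.
Qed.

End GaussKernel.

(** * Lower and upper bounds for the worst-case error *)

Section WorstCase.
Context {R : realType} {a b : R} {L : (Omega a b -> R) -> R} {N : nat}.
Hypotheses (ab : a < b) (Lpos : positive_linear_functional L).
Implicit Types (f : Omega a b -> R) (x y : Omega a b).

(** A discrete stand-in for L - Q: it converges to it on Lipschitz functions, and its mass does not
    depend on n. *)
Definition quad_defect (X : 'rV[Omega a b]_N) (w : 'rV[R]_N) n : seq (R * Omega a b) :=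
  discretization L ab n ++ [seq (- w ord0 i, X ord0 i) | i <- index_enum 'I_N].

Section Rule.
Variables (X : 'rV[Omega a b]_N) (w : 'rV[R]_N).
Let mu := quad_defect X w.
Let mass := tmass L + \sum_(i < N) `|w ord0 i|.

Lemma dmeas_quad_defect n f : dmeas (mu n) f = dmeas (discretization L ab n) f - quad X w f.
Proof.
rewrite dmeas_cat /quad; congr (_ + _); rewrite /dmeas big_map -sumrN.
by apply: eq_bigr => i _; rewrite mulNr.
Qed.

Lemma dmass_quad_defect n : dmass (mu n) = mass.
Proof.
rewrite dmass_cat dmass_discretization//; congr (_ + _); rewrite /dmass big_map.
by apply: eq_bigr => i _; rewrite normrN.
Qed.

Lemma quad_defect_cvg f : (exists M, lip M f) ->
  dmeas (mu n) f @[n --> \oo] --> L f - quad X w f.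
Proof.
move=> hf; under eq_fun do rewrite dmeas_quad_defect.
by apply: cvgB; [exact: discretization_cvg|exact: cvg_cst].
Qed.

Lemma mass_ge0 : 0 <= mass.
Proof. by rewrite addr_ge0 ?tmass_ge0 ?sumr_ge0. Qed.

Lemma quadZ c f : quad X w (c *: f) = c * quad X w f.
Proof. by rewrite /quad mulr_sumr; apply: eq_bigr => i _; rewrite mulrCA. Qed.

Lemma quad0 : quad X w 0 = 0.
Proof. by rewrite /quad big1// => i _; rewrite mulr0. Qed.

Section Kernel.
Variables (ell : R) (H : hilbertFunSpace R (Omega a b)).
Hypotheses (l0 : 0 < ell) (KH : is_rkhs (gauss_kernel ell) H).
Notation K := (gauss_kernel ell).
Notation wce := (worst_case_error L H X w).

Lemma gauss_kernel_diag x : K x x = 1.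
Proof. by rewrite /gauss_kernel subrr expr0n oppr0 mul0r expR0. Qed.

Lemma gauss_kernelC x y : K x y = K y x.
Proof. by rewrite /gauss_kernel -sqrrN opprB. Qed.

Lemma rkhs_le f x : carrier H f -> `|f x| <= hnorm H f.
Proof.
move=> Hf; have := dmeas_le_energy KH [:: (1, x)] f Hf.
rewrite /dmeas !big_seq1 gauss_kernel_diag !mul1r mulr1 -(sqr_hnorm f Hf).
by rewrite -[X in X <= _]real_normK ?num_real// ler_pXn2r// ?nnegrE ?sqrtr_ge0.
Qed.

(** The measure delta_x - delta_y has energy 2 - 2 K(x,y), which is at most (x-y)^2 / ell^2 because
    1 - e^(-t) <= t. *)
Lemma rkhs_lip f : carrier H f -> lip (hnorm H f / ell) f.
Proof.
move=> Hf x y; have := dmeas_le_energy KH [:: (1, x); (-1, y)] f Hf.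
rewrite /dmeas !(big_cons, big_nil)/= !gauss_kernel_diag (gauss_kernelC y) -sqr_hnorm//.
rewrite !addr0 !mul1r !mulN1r => h.
rewrite -(@ler_pXn2r _ 2) ?nnegrE ?mulr_ge0 ?invr_ge0 ?sqrtr_ge0 ?(ltW l0)//.
rewrite real_normK ?num_real//; apply: (le_trans h).
rewrite exprMn real_normK ?num_real// exprMn -mulrA ler_wpM2l ?sqr_ge0//.
rewrite /gauss_kernel; have := expR_ge1Dx (- (val x - val y) ^+ 2 / (2 * ell ^+ 2)).
have -> : ell^-1 ^+ 2 * (val x - val y) ^+ 2 = - 2 * (- (val x - val y) ^+ 2 / (2 * ell ^+ 2)).
  by field; rewrite gt_eqF.
set e := expR _; set t := _ / _; lra.
Qed.

Lemma rkhs_cont f : carrier H f -> continuous f.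
Proof. by move=> Hf; exact: lip_continuous (rkhs_lip f Hf). Qed.

Let errs := [set `|L f - quad X w f| | f in [set f | carrier H f /\ hnorm H f <= 1]].

(** Boundedness is what makes the real [sup] an actual upper bound of the errors; elements of the
    unit ball satisfy |f| <= 1 pointwise since K(x,x) = 1. *)
Lemma errs_bounded : has_ubound errs.
Proof.
exists mass => _ [f [Hf f1] <-].
have le1 x : `|f x| <= 1 by apply: (le_trans (rkhs_le f x Hf)).
apply: (le_trans (ler_normB _ _)); apply: lerD.
  by rewrite -[leRHS]mul1r; apply: norm_funct_le => //; exact: rkhs_cont.
apply: (le_trans (ler_norm_sum _ _ _)); apply: ler_sum => i _.
by rewrite normrM ler_piMr.
Qed.

Lemma hnorm0 : hnorm H 0 = 0.
Proof. by rewrite /hnorm inner0 ?sqrtr0//; exact: carrier0. Qed.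

Lemma errs0 : errs 0.
Proof.
exists 0; first by split; [exact: carrier0|rewrite hnorm0].
by rewrite quad0 (funct0 Lpos) subrr normr0.
Qed.

Lemma wce_ge0 : 0 <= wce.
Proof. exact: (ub_le_sup errs_bounded errs0). Qed.

Lemma wce_ub f : carrier H f -> `|L f - quad X w f| <= wce * hnorm H f.
Proof.
move=> Hf; have [f0|f0] := eqVneq (hnorm H f) 0.
  have -> : f = 0.
    by apply: (inner_eq0 Hf); rewrite -sqr_hnorm// f0 expr0n.
  by rewrite quad0 (funct0 Lpos) subrr normr0 hnorm0 mulr0.
have n0 : 0 < hnorm H f by rewrite lt_def f0 sqrtr_ge0.
rewrite -ler_pdivrMr//; apply: (ub_le_sup errs_bounded).
exists ((hnorm H f)^-1 *: f).
  split; first exact: carrierZ.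
  move: n0; move En : (hnorm H f) => r r0.
  rewrite /hnorm innerZ//; last exact: carrierZ.
  rewrite inner_sym//; last exact: carrierZ.
  rewrite innerZ// -sqr_hnorm// En.
  by rewrite (_ : _ * _ = 1) ?sqrtr1//; field; rewrite gt_eqF.
rewrite quadZ (functZ Lpos _ _ (rkhs_cont f Hf)) -mulrBr normrM mulrC.
by rewrite normfV (gtr0_norm n0).
Qed.

Let energy n := dmeas (mu n) (fun x => dmeas (mu n) (K x)).

(** The discretization error for an f of norm 1, whose Lipschitz constant is 1/ell. *)
Let delta n : R := (b - a) / n.+1%:R * tmass L / ell.

(** The test function is the representer h of [mu n]: the energy is both its squared norm and [mu n]
    applied to h, and the latter differs from (L - Q) h by at most [delta n] times the norm. *)
Lemma sqrt_energy_le_wce n : Num.sqrt (energy n) <= wce + delta n.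
Proof.
pose h := representer (K := K) (mu n).
have Hh : carrier H h by exact: representer_carrier.
have hE : hnorm H h = Num.sqrt (energy n) by rewrite /hnorm (hnorm_representer KH).
rewrite -hE; have [->|h0] := eqVneq (hnorm H h) 0.
  rewrite addr_ge0 ?wce_ge0// /delta !mulr_ge0 ?tmass_ge0 ?invr_ge0// ?ltW//.
  by rewrite subr_gt0.
have n0 : 0 < hnorm H h by rewrite lt_def h0 sqrtr_ge0.
rewrite -(ler_pM2r n0) -expr2 sqr_hnorm// (inner_representer KH)// dmeas_quad_defect.
have e1 := wce_ub _ Hh.
have e2 : `|L h - dmeas (discretization L ab n) h| <= delta n * hnorm H h.
  have := discretization_error ab Lpos n _ _ _ (rkhs_lip _ Hh).
  move=> /(_ _)/le_trans; apply; first by rewrite divr_ge0 ?sqrtr_ge0 ?ltW.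
  rewrite le_eqVlt; apply/orP; left; apply/eqP; rewrite /delta; field.
  by rewrite (gt_eqF l0) addrC natr1 pnatr_eq0.
move: e1 e2; rewrite !ler_norml mulrDl => /andP[_ e1] /andP[e2 _]; lra.
Qed.

Lemma wce_kfeature k :
  `|L (kfeature ell k) - quad X w (kfeature ell k)| <= k`!%:R * ell ^+ k * wce.
Proof.
have f0 : 0 <= k`!%:R * ell ^+ k :> R by rewrite mulr_ge0 ?exprn_ge0 ?ltW.
have bound n : `|dmeas (mu n) (kfeature ell k)| <= k`!%:R * ell ^+ k * (wce + delta n).
  apply: (@le_trans _ _ (k`!%:R * ell ^+ k * Num.sqrt (energy n))); last first.
    by rewrite ler_wpM2l// sqrt_energy_le_wce.
  rewrite -(@ler_pXn2r _ 2) ?nnegrE ?mulr_ge0 ?sqrtr_ge0 ?exprn_ge0 ?(ltW l0)//.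
  rewrite real_normK ?num_real// exprMn sqr_sqrtr ?(energy_ge0 KH)//.
  (* The sharp factor is sqrt(k!) ell^k; it is weakened through k! <= (k!)^2. *)
  apply: (le_trans (energy_ge_kfeature _ _ k l0)).
  rewrite ler_wpM2r ?(energy_ge0 KH)// exprMn -exprM mulnC.
  rewrite ler_wpM2r ?exprn_ge0 ?(ltW l0)// -natrX ler_nat expnS leq_pmulr//.
  by rewrite expn_gt0 fact_gt0.
have c1 : `|dmeas (mu n) (kfeature ell k)| @[n --> \oo] -->
    `|L (kfeature ell k) - quad X w (kfeature ell k)|.
  by apply: cvg_norm; apply: quad_defect_cvg; exact: ex_lip_kfeature.
have c2 : k`!%:R * ell ^+ k * (wce + delta n) @[n --> \oo] --> k`!%:R * ell ^+ k * wce.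
  apply: cvgM; first exact: cvg_cst.
  rewrite -[X in _ --> X]addr0; apply: cvgD; first exact: cvg_cst.
  have lim0 : (b - a) * 0 * tmass L / ell = 0 by rewrite mulr0 !mul0r.
  rewrite -[X in _ --> X]lim0.
  apply: cvgMl; apply: cvgMl; apply: cvgM; [exact: cvg_cst|exact: cvg_harmonic].
apply: (ler_cvg_to c1 c2).
by apply: nearW.
Qed.

(** The energy of [mu n] splits along K = P + (K - P), with P the Taylor polynomial. The P-part
    tends to 0 by exactness of the rule, and the rest is at most [mass ^+ 2 * rho]. *)
Lemma sqr_error_le f rho : carrier H f -> (1 <= N)%N ->
  (forall k, (k <= 2 * N - 1)%N -> quad X w (monomial k) = L (monomial k)) ->
  (forall x y, `|K x y - series (exp_coeff (- ((val x - val y) ^+ 2 / (2 * ell ^+ 2)))) (2 * N)%N|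
     <= rho) ->
  (L f - quad X w f) ^+ 2 <= inner H f f * (mass ^+ 2 * rho).
Proof.
move=> Hf N0 exact_rule rem_le.
pose P x y := series (exp_coeff (- ((val x - val y) ^+ 2 / (2 * ell ^+ 2)))) (2 * N)%N.
(* The coefficient of x^(2m-i) y^i in P: the m-th exponential coefficient times the binomial one
   from (x-y)^(2m). *)
pose c (m i : nat) : R :=
  (- (2 * ell ^+ 2)^-1) ^+ m / m`!%:R * (-1) ^+ i *+ 'C(2 * m, i).
have PE x y : P x y = \sum_(0 <= m < 2 * N) \sum_(i < (2 * m).+1)
    c m i * (monomial (2 * m - i) x * monomial i y).
  rewrite /P seriesEnat; apply: eq_bigr => m _.
  have -> z : exp_coeff (- (z ^+ 2 / (2 * ell ^+ 2))) m =
      (- (2 * ell ^+ 2)^-1) ^+ m / m`!%:R * z ^+ (2 * m).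
    by rewrite (mulrC (z ^+ 2)) -mulNr /exp_coeff/= exprMn -exprM mulrAC.
  rewrite exprBn mulr_sumr; apply: eq_bigr => i _.
  by rewrite /c /monomial [LHS]mulrnAr [RHS]mulrnAl; congr (_ *+ _); rewrite !mulrA.
have EE n : energy n = dmeas (mu n) (fun x => dmeas (mu n) (P x)) +
    dmeas (mu n) (fun x => dmeas (mu n) (fun y => K x y - P x y)).
  rewrite -dmeasD; congr dmeas; apply/funext => x.
  rewrite -dmeasD; congr dmeas; apply/funext => y; by rewrite addrC subrK.
have PPE n : dmeas (mu n) (fun x => dmeas (mu n) (P x)) =
    \sum_(0 <= m < 2 * N) \sum_(i < (2 * m).+1)
    c m i * (dmeas (mu n) (monomial (2 * m - i)) * dmeas (mu n) (monomial i)).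
  transitivity (dmeas (mu n) (fun x => \sum_(0 <= m < 2 * N) \sum_(i < (2 * m).+1)
      c m i * (monomial (2 * m - i) x * dmeas (mu n) (monomial i)))).
    congr dmeas; apply/funext => x.
    transitivity (dmeas (mu n) (fun y => \sum_(0 <= m < 2 * N) \sum_(i < (2 * m).+1)
       c m i * (monomial (2 * m - i) x * monomial i y))).
      by congr dmeas; apply/funext => y; rewrite PE.
    rewrite dmeas_sum; apply: eq_bigr => m _; rewrite dmeas_sum; apply: eq_bigr => i _.
    by rewrite dmeasM dmeasM.
  rewrite dmeas_sum; apply: eq_bigr => m _; rewrite dmeas_sum; apply: eq_bigr => i _.
  rewrite dmeasM; congr (_ * _); rewrite [RHS]mulrC -dmeasM.
  by congr dmeas; apply/funext => x; rewrite mulrC.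
have cP : dmeas (mu n) (fun x => dmeas (mu n) (P x)) @[n --> \oo] --> 0.
  have lim0 : \sum_(0 <= m < 2 * N) \sum_(i < (2 * m).+1)
    c m i * ((L (monomial (2 * m - i)) - quad X w (monomial (2 * m - i))) *
     (L (monomial i) - quad X w (monomial i))) = 0.
    rewrite big_nat_cond big1// => m /andP[/andP[_ mN] _].
    rewrite big1// => i _.
    (* The exponents 2m - i and i add up to at most 4N - 2, so one of them is at most 2N - 1 and its
       defect vanishes. *)
    have [iN|iN] := leqP i (2 * N - 1)%N.
      by rewrite [X in _ * (_ * (_ - X))]exact_rule// subrr !mulr0.
    by rewrite [X in _ * ((_ - X) * _)]exact_rule ?subrr ?mul0r ?mulr0//; lia.
  rewrite -[X in _ --> X]lim0; under eq_fun do rewrite PPE.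
  apply: cvg_sumr => m; apply: cvg_sumr => i; apply: cvgM; first exact: cvg_cst.
  by apply: cvgM; apply: quad_defect_cvg; exact: ex_lip_monomial.
have rr n : `|dmeas (mu n) (fun x => dmeas (mu n) (fun y => K x y - P x y))| <= mass ^+ 2 * rho.
  rewrite expr2 -mulrA -{1}(dmass_quad_defect n); apply: le_dmeas => x.
  by rewrite -(dmass_quad_defect n); apply: le_dmeas => y; exact: rem_le.
have cf : dmeas (mu n) f ^+ 2 @[n --> \oo] --> (L f - quad X w f) ^+ 2.
  have h : dmeas (mu n) f @[n --> \oo] --> L f - quad X w f.
    by apply: quad_defect_cvg; exists (hnorm H f / ell); exact: rkhs_lip.
  by rewrite expr2; under eq_fun do rewrite expr2; exact: cvgM.
have cg : inner H f f * (dmeas (mu n) (fun x => dmeas (mu n) (P x)) + mass ^+ 2 * rho)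
    @[n --> \oo] --> inner H f f * (mass ^+ 2 * rho).
  apply: cvgM; first exact: cvg_cst.
  by rewrite -[X in _ --> X]add0r; apply: cvgD => //; exact: cvg_cst.
apply: (ler_cvg_to cf cg).
apply: nearW => n; apply: (le_trans (dmeas_le_energy KH (mu n) f Hf)).
rewrite ler_wpM2l ?inner_ge0// -/(energy n) EE lerD2l.
exact: (le_trans (ler_norm _) (rr n)).
Qed.

End Kernel.

(** With t = (x-y)^2 / (2 ell^2), the Taylor remainder of K is at most t^(2N) e^t, and t <= (b-a)^2
    / ell^2. For ell >= 1 the factor e^t is bounded uniformly, so the constant is independent of
    ell. *)
Lemma wce_exact_rule : (1 <= N)%N ->
  (forall k, (k <= 2 * N - 1)%N -> quad X w (monomial k) = L (monomial k)) ->
  exists2 C : R, 0 < C & forall ell H, 1 <= ell -> is_rkhs (gauss_kernel ell) H ->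
    worst_case_error L H X w <= C * ell ^- (2 * N).
Proof.
move=> N0 exact_rule; have := sqr_ge0 (b - a); move zE : ((b - a) ^+ 2) => z z0.
(* The bound e^t <= e^(2z) is generous, so that the remainder bound becomes the square of z^N e^z
   ell^(-2N). The constant used is C + 1, to be positive. *)
pose C : R := mass * (z ^+ N * expR z).
have C0 : 0 <= C by rewrite /C mulr_ge0 ?mass_ge0// mulr_ge0 ?exprn_ge0 ?expR_ge0.
exists (C + 1); first by apply: ltr_wpDl.
move=> ell H l1 KH; have l0 : 0 < ell by exact: lt_le_trans l1.
have v0 : 0 <= ell ^- (2 * N) by rewrite invr_ge0 exprn_ge0 ?ltW.
apply: ge_sup.
  by exists 0; exact: (errs0 H).
move=> _ [f [Hf f1] <-].
apply: (@le_trans _ _ (C * ell ^- (2 * N))); last first.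
  by rewrite ler_wpM2r// lerDl.
rewrite -(@ler_pXn2r _ 2) ?nnegrE ?(mulr_ge0 C0 v0)// real_normK ?num_real//.
apply: le_trans (sqr_error_le ell H l0 KH f
    ((z ^+ N * expR z) ^+ 2 * (ell ^- (2 * N)) ^+ 2) Hf N0 exact_rule _) _; last first.
  have -> : (C * ell ^- (2 * N)) ^+ 2 =
    mass ^+ 2 * ((z ^+ N * expR z) ^+ 2 * (ell ^- (2 * N)) ^+ 2) by rewrite -!exprMn /C !mulrA.
  rewrite ler_piMl//.
    by apply: mulr_ge0; [exact: sqr_ge0|apply: mulr_ge0; exact: sqr_ge0].
  by rewrite -sqr_hnorm// -(expr1n _ 2) ler_pXn2r// ?nnegrE ?sqrtr_ge0.
move=> x y; set t := (val x - val y) ^+ 2 / (2 * ell ^+ 2).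
have t0 : 0 <= t by rewrite divr_ge0 ?sqr_ge0// mulr_ge0// sqr_ge0.
have tz : t <= z / ell ^+ 2.
  rewrite /t invfM mulrA ler_wpM2r ?invr_ge0 ?sqr_ge0// ler_pdivrMr//.
  rewrite -zE; have /andP[? ?] := omega_itv x; have /andP[? ?] := omega_itv y.
  apply: (@le_trans _ _ ((b - a) ^+ 2)).
    have h : `|val x - val y| <= b - a by rewrite ler_norml; apply/andP; split; lra.
    rewrite -[leLHS](real_normK (num_real _)) ler_pXn2r ?nnegrE//.
    by rewrite subr_ge0 ltW.
  by rewrite mulr_natr mulr2n lerDl sqr_ge0.
have tz' : t <= z.
  apply: (le_trans tz); rewrite ler_pdivrMr ?exprn_gt0// ler_peMr//.
  by rewrite -(expr1n _ 2) ler_pXn2r// ?nnegrE// ltW.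
have -> : gauss_kernel ell x y = expR (- t) by rewrite /gauss_kernel mulNr.
apply: (le_trans (expRN_taylor t (2 * N) t0)).
have -> : (z ^+ N * expR z) ^+ 2 * ell ^- (2 * N) ^+ 2 =
   (z / ell ^+ 2) ^+ (2 * N) * expR z ^+ 2.
  have e : (ell^-1 ^+ (2 * N)) ^+ 2 = (ell^-1 ^+ 2) ^+ (2 * N).
    by rewrite -[LHS]exprM -[RHS]exprM mulnC.
  rewrite -!exprVn e [X in X * _]exprMn [X in _ = X * _]exprMn mulrAC.
  by rewrite -[z ^+ N ^+ 2]exprM (mulnC N).
apply: ler_pM; rewrite ?exprn_ge0 ?expR_ge0//.
  by rewrite ler_pXn2r ?muln_gt0// ?nnegrE ?(divr_ge0 z0)// sqr_ge0.
rewrite expr2 -expRD ler_expR; lra.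
Qed.

End Rule.
End WorstCase.

(** * Functionals supported on finitely many points *)

Section Moments.
Context {R : realType} {a b : R} {L : (Omega a b -> R) -> R}.
Hypotheses (ab : a < b) (Lpos : positive_linear_functional L).
Implicit Types (p q : {poly R}) (f : Omega a b -> R).

Definition polyL p : R := L (fun x => p.[val x]).

Lemma horner_cont p : continuous (fun x : Omega a b => p.[val x]).
Proof. exact: (lip_cont _ (ex_lip_horner ab p)). Qed.

Lemma polyLD p q : polyL (p + q) = polyL p + polyL q.
Proof.
rewrite /polyL -(functD Lpos); do ?exact: horner_cont.
by congr L; apply/funext => x; rewrite hornerD.
Qed.

Lemma polyLZ c p : polyL (c *: p) = c * polyL p.
Proof.
rewrite /polyL -(functZ Lpos); last exact: horner_cont.
by congr L; apply/funext => x; rewrite hornerZ.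
Qed.

Lemma polyLB p q : polyL (p - q) = polyL p - polyL q.
Proof. by rewrite polyLD -scaleN1r polyLZ mulN1r. Qed.

Lemma polyL_sum (I : Type) (r : seq I) (F : I -> {poly R}) :
  polyL (\sum_(i <- r) F i) = \sum_(i <- r) polyL (F i).
Proof.
rewrite /polyL -(funct_sum Lpos); last by move=> i; exact: horner_cont.
by congr L; apply/funext => x; rewrite horner_sum.
Qed.

Lemma polyL_ge0 p : (forall x : Omega a b, 0 <= p.[val x]) -> 0 <= polyL p.
Proof. by move=> p0; apply: (proj2 Lpos) => //; exact: horner_cont. Qed.

Lemma polyL_sqr_ge0 p : 0 <= polyL (p ^+ 2).
Proof. by apply: polyL_ge0 => x; rewrite horner_exp sqr_ge0. Qed.

(** Reduces limits of [polyL] along varying polynomials of bounded size to limits of finitely many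
    coefficients. *)
Lemma polyLE n p : (size p <= n)%N -> polyL p = \sum_(k < n) p`_k * L (monomial k).
Proof.
move=> pn; have {1}-> : p = \sum_(k < n) p`_k *: 'X^k.
  rewrite -poly_def; apply/polyP => i; rewrite coef_poly; case: ltnP => // ni.
  by rewrite nth_default// (leq_trans pn).
rewrite polyL_sum; apply: eq_bigr => k _; rewrite polyLZ; congr (_ * L _).
by apply/funext => x; rewrite hornerXn.
Qed.

End Moments.

Arguments polyL {R a b} L p.

Section Degenerate.
Context {R : realType} {a b : R} {L : (Omega a b -> R) -> R}.
Hypotheses (ab : a < b) (Lpos : positive_linear_functional L).
Implicit Types (f : Omega a b -> R) (s t : seq (Omega a b)).

Definition nodal s : {poly R} := \prod_(y <- s) ('X - (val y)%:P).

(** Within e of a point of [s], |f| <= M e because f vanishes there; elsewhere |f| is dominated by a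
    multiple of the squared nodal polynomial, which [L] kills. Positivity gives |L f| <= e M L(1)
    for every e > 0. *)
Lemma funct_supported s f : polyL L (nodal s ^+ 2) = 0 -> (exists M, lip M f) ->
  (forall y, y \in s -> f y = 0) -> L f = 0.
Proof.
move=> Ls0 [M0 fM0] fs0.
have [M Mge fM] : exists2 M, 0 <= M & lip M f.
  by exists `|M0| => // x y; apply: (le_trans (fM0 x y)); rewrite ler_wpM2r// ler_norm.
have [C C0 fC] := lip_bounded ab _ _ fM.
have key e : 0 < e -> `|L f| <= e * (M * tmass L).
  (* Farther than e from all of [s], the squared nodal polynomial is at least e^(2 |s|), so D times
     it exceeds the bound C of |f|. *)
  move=> e0; pose D := C / e ^+ (2 * size s).
  have D0 : 0 <= D by rewrite divr_ge0 ?exprn_ge0 ?(ltW e0).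
  pose g (x : Omega a b) := (M * e)%:P.[val x] + (D *: nodal s ^+ 2).[val x].
  have gE : L g = e * (M * tmass L).
    rewrite /g (functD Lpos); do ?exact: horner_cont.
    rewrite -/(polyL L (D *: _)) (polyLZ ab Lpos) Ls0 mulr0 addr0.
    have -> : (fun x : Omega a b => (M * e)%:P.[val x]) = (fun=> M * e * 1).
      by apply/funext => x; rewrite hornerC mulr1.
    by rewrite (functZ Lpos)// -/(tmass L); [ring|exact: cst_continuous].
  have fg x : `|f x| <= g x.
    rewrite /g hornerC hornerZ horner_exp; have [/hasP[y ys xy]|/hasPn far] :=
      boolP (has (fun y : Omega a b => `|val x - val y| <= e) s).
      apply: (@le_trans _ _ (M * e)); last by rewrite lerDl mulr_ge0 ?sqr_ge0.
      rewrite -[f x]subr0 -(fs0 y ys); apply: (le_trans (fM x y)).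
      by rewrite ler_wpM2l.
    apply: (le_trans (fC x)).
    have far' : e ^+ size s <= `|(nodal s).[val x]|.
      rewrite /nodal; elim: {fs0 Ls0 D D0 g gE} s far => [_|y s IH far].
        by rewrite big_nil hornerC normr1.
      rewrite big_cons hornerM normrM hornerXsubC exprS.
      have y_s : y \in y :: s by rewrite mem_head.
      apply: ler_pM; rewrite ?exprn_ge0 ?(ltW e0)//.
        by have := far _ y_s; rewrite -ltNge => /ltW.
      by apply: IH => z zs; apply: far; rewrite in_cons zs orbT.
    have far2 : e ^+ (2 * size s) <= (nodal s).[val x] ^+ 2.
      rewrite mulnC exprM -[leRHS](real_normK (num_real _)).
      by rewrite ler_pXn2r// ?nnegrE ?exprn_ge0 ?(ltW e0).
    apply: (@le_trans _ _ (D * (nodal s).[val x] ^+ 2)); last first.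
      by rewrite lerDr mulr_ge0 ?(ltW e0).
    by rewrite /D -mulrA ler_peMr// mulrC ler_pdivlMr ?exprn_gt0// mul1r.
  have cf : continuous f by exact: lip_continuous fM.
  have cg : continuous g.
    have -> : g = (fun x => ((M * e)%:P + (D *: nodal s ^+ 2)).[val x]).
      by apply/funext => x; rewrite hornerD.
    exact: horner_cont.
  rewrite -gE ler_norml -[X in X <= _]mulN1r -(functZ Lpos)//.
  apply/andP; split; apply: (le_funct Lpos) => //; first exact: contZ.
    by move=> x; have := fg x; rewrite mulN1r ler_norml => /andP[].
  by move=> x; have := fg x; rewrite ler_norml => /andP[].
apply/eqP; rewrite -normr_eq0 eq_le normr_ge0 andbT.
apply/ler_addgt0Pr => e e0; rewrite add0r.
have K0 : 0 <= M * tmass L by rewrite mulr_ge0// (tmass_ge0 Lpos).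
have K1 : 0 < M * tmass L + 1 by rewrite ltr_wpDl.
apply: (le_trans (key (e / (M * tmass L + 1)) _)); first by rewrite divr_gt0.
by rewrite mulrAC ler_pdivrMr// ler_wpM2l ?(ltW e0)// lerDl.
Qed.

Lemma nodal_cons y s : nodal (y :: s) = ('X - (val y)%:P) * nodal s.
Proof. by rewrite /nodal big_cons. Qed.

Lemma root_nodal s y : y \in s -> (nodal s).[val y] = 0.
Proof.
elim: s => // z s IH; rewrite in_cons nodal_cons hornerM hornerXsubC => /orP[/eqP->|/IH->].
  by rewrite subrr mul0r.
by rewrite mulr0.
Qed.

Lemma nodal_neq0 s y : y \notin s -> (nodal s).[val y] != 0.
Proof.
elim: s => [_|z s IH]; first by rewrite /nodal big_nil hornerC oner_neq0.
rewrite in_cons negb_or nodal_cons hornerM hornerXsubC => /andP[yz /IH ys].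
by rewrite mulf_neq0// subr_eq0; apply: contra_neq yz => /val_inj.
Qed.

(** Induction on [t]: if y is not in [t], the normalised nodal polynomial g of [t] has g(y) = 1 and
    vanishes on [t], so A - A(g) delta_y satisfies the hypotheses for [t]. A repeated point receives
    weight 0. *)
Lemma discrete_functional (A : (Omega a b -> R) -> R) t :
  (forall c f g, (exists M, lip M f) -> (exists M, lip M g) ->
     A (fun x => c * f x + g x) = c * A f + A g) ->
  (forall f, (exists M, lip M f) -> (forall y, y \in t -> f y = 0) -> A f = 0) ->
  exists2 u : seq R, size u = size t &
    forall f, (exists M, lip M f) -> A f = dmeas (zip u t) f.
Proof.
elim: t A => [|y t IH] A Alin A0.
  by exists [::] => // f lf; rewrite A0// /dmeas big_nil.
have [yt|yt] := boolP (y \in t).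
  have [|u su uE] := IH A Alin.
    by move=> f lf ft; apply: A0 => // z; rewrite in_cons => /orP[/eqP->|]; exact: ft.
  exists (0 :: u); first by rewrite /= su.
  by move=> f lf; rewrite uE// /dmeas big_cons mul0r add0r.
pose p : {poly R} := ((nodal t).[val y])^-1 *: nodal t.
pose g (x : Omega a b) := p.[val x].
have lg : exists M, lip M g by exact: ex_lip_horner.
have gy : g y = 1 by rewrite /g hornerZ mulVf// nodal_neq0.
have gt z : z \in t -> g z = 0 by move=> zt; rewrite /g hornerZ (root_nodal _ _ zt) mulr0.
have lcomb c f : (exists M, lip M f) -> exists M, lip M (fun x => c * g x + f x).
  case=> M fM; have [M' gM] := lg.
  by exists (`|c| * M' + M); apply: lipD => //; exact: lipZ.
pose B f := A f - f y * A g.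
have [|f lf ft|u su uE] := IH B.
- move=> c f h lf lh; rewrite /B Alin//; ring.
- have := A0 (fun x => - f y * g x + f x) (lcomb _ _ lf).
  rewrite Alin// mulNr addrC; apply => z; rewrite in_cons => /orP[/eqP->|zt].
    by rewrite gy mulr1 addNr.
  by rewrite (gt z zt) (ft z zt) mulr0 addr0.
exists (A g :: u); first by rewrite /= su.
move=> f lf; have := uE f lf; rewrite /B /dmeas big_cons/= => <-; ring.
Qed.

End Degenerate.

Section Nondegenerate.
Context {R : realType} {a b : R} {L : (Omega a b -> R) -> R} {N : nat}
  {ell : R} {H : hilbertFunSpace R (Omega a b)}
  {X0 : 'rV[Omega a b]_N} {w0 : 'rV[R]_N}.
Hypotheses (ab : a < b) (Lpos : positive_linear_functional L)
  (l0 : 0 < ell) (KH : is_rkhs (gauss_kernel ell) H)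
  (uniq_opt : is_the_unique_rule (optimal_rule L H) X0 w0).

(** Zero error is minimal, since worst-case errors are nonnegative. *)
Lemma optimal_of_exact (X : 'rV[Omega a b]_N) w : ascending X ->
  (forall f, carrier H f -> L f = quad X w f) -> optimal_rule L H X w.
Proof.
move=> Xasc exactX; split => //.
have w_ge0 (p : 'rV[Omega a b]_N * 'rV[R]_N) : 0 <= worst_case_error L H p.1 p.2.
  exact: (wce_ge0 Lpos p.1 p.2 ell H l0 KH).
have Xw0 : worst_case_error L H X w = 0.
  apply/eqP; rewrite eq_le (w_ge0 (X, w)) andbT; apply: ge_sup.
    by exists 0; exact: (errs0 Lpos X w H).
  by move=> _ [f [Hf _] <-]; rewrite exactX// subrr normr0.
rewrite Xw0; apply/eqP; rewrite eq_le; apply/andP; split.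
  apply: lb_le_inf; first by exists 0, (X, w).
  by move=> _ [p _ <-]; exact: w_ge0.
apply: ge_inf; last by exists (X, w).
by exists 0 => _ [p _ <-]; exact: w_ge0.
Qed.

(* Otherwise L is supported on s, and adding a or b to s as an N-th node gives two different
   rules with zero error. *)
Lemma unique_optimal_nondegenerate (s : seq (Omega a b)) : size s = N.-1 -> (0 < N)%N ->
  0 < polyL L (nodal s ^+ 2).
Proof.
move=> sN N0; rewrite lt_def (polyL_sqr_ge0 ab Lpos) andbT; apply/eqP => Ls0.
pose le_val := relpre (val : Omega a b -> R) <=%R.
(* Here z is the extra node, later a or b; sorting provides the ascending order. *)
pose t z := sort le_val (z :: s).
have st z : size (t z) = N by rewrite size_sort /= sN prednK.
pose X z : 'rV[Omega a b]_N := \row_i nth z (t z) i.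
have Xasc z : ascending (X z).
  move=> i j ij; rewrite !mxE.
  have := @sorted_leq_nth _ le_val _ _ z (t z).
  apply => //; rewrite ?inE ?st//.
  - by move=> x y w; exact: le_trans.
  - by move=> x; exact: lexx.
  - by apply: sort_sorted => x y; exact: le_total.
have X0E z : X z = X0.
  have [||u su uE] := discrete_functional ab L (t z).
  - move=> c f g lf lg; rewrite -(functZ Lpos) -?(functD Lpos) //; try exact: lip_cont.
    exact/contZ/lip_cont.
  - move=> f lf ft; apply: (funct_supported ab Lpos s) => // y ys; apply: ft.
    by rewrite mem_sort in_cons ys orbT.
  have [] := proj2 uniq_opt (X z) (\row_i nth 0 u i); last by [].
  apply: optimal_of_exact => // f Hf; rewrite uE; last first.
    by exists (hnorm H f / ell); exact: rkhs_lip.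
  rewrite /quad /dmeas (big_nth (0, z)) size_zip su st minnn big_mkord.
  by apply: eq_bigr => i _; rewrite !mxE nth_zip//= su st.
have tE x y : t x = t y.
  apply: (@eq_from_nth _ x); rewrite ?st// => i iN.
  have := congr1 (fun Y : 'rV_N => Y ord0 (Ordinal iN)) (etrans (X0E x) (esym (X0E y))).
  by rewrite !mxE/= => ->; apply: set_nth_default; rewrite st.
have hb : a <= b <= b by rewrite lexx ltW.
have ha : a <= a <= b by rewrite lexx ltW.
(* Both rules share the nodes [X0]; cancelling [s] would leave a = b. *)
have : perm_eq ([:: omega ab a] ++ s) ([:: omega ab b] ++ s).
  by rewrite -(perm_sort le_val) -/(t _) (tE _ (omega ab b)) perm_sort.
rewrite perm_cat2r => /perm_mem/(_ (omega ab a)); rewrite !inE eqxx => /esym/eqP.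
move=> /(congr1 val); rewrite !omegaK// => /eqP; apply/negP; rewrite lt_eqF//.
Qed.

End Nondegenerate.

(** * Existence of the Gaussian quadrature rule *)

Section CoefConvergence.
Context {R : realType} {T : Type} {F : set_system T} {FF : Filter F}.

Lemma coefM_cvg (G1 G2 : T -> {poly R}) (p q : {poly R}) :
  (forall k, (G1 t)`_k @[t --> F] --> p`_k) -> (forall k, (G2 t)`_k @[t --> F] --> q`_k) ->
  forall k, (G1 t * G2 t)`_k @[t --> F] --> (p * q)`_k.
Proof.
move=> h1 h2 k; rewrite coefM; under eq_fun do rewrite coefM.
by apply: cvg_sumr => i; apply: cvgM; [exact: h1|exact: h2].
Qed.

Lemma prod_XsubC_coef_cvg (I : Type) (r : seq I) (P : pred I) (x : T -> I -> R) (x0 : I -> R) :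
  (forall i, x t i @[t --> F] --> x0 i) ->
  forall k, (\prod_(i <- r | P i) ('X - (x t i)%:P))`_k @[t --> F] -->
    (\prod_(i <- r | P i) ('X - (x0 i)%:P))`_k.
Proof.
move=> xx0; elim: r => [|i r IH] k.
  by under eq_fun do rewrite big_nil; rewrite big_nil; exact: cvg_cst.
rewrite big_cons; under eq_fun do rewrite big_cons; case: (P i); last exact: IH.
apply: coefM_cvg => // {}k; rewrite coefB coefX coefC.
under eq_fun do rewrite coefB coefX coefC.
apply: cvgB; first exact: cvg_cst.
by case: (k == 0)%N; [exact: xx0|exact: cvg_cst].
Qed.

End CoefConvergence.

(** * Node polynomials and Lagrange interpolation *)

Section NodePolynomials.
Context {R : realType} {N : nat}.
Implicit Types (x : 'I_N -> R) (i j : 'I_N).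

Definition nodepoly x : {poly R} := \prod_j ('X - (x j)%:P).

Definition nodepoly_but x i : {poly R} := \prod_(j | j != i) ('X - (x j)%:P).

Definition set_node x i (t : R) j : R := if j == i then t else x j.

Lemma nodepolyE x i : nodepoly x = ('X - (x i)%:P) * nodepoly_but x i.
Proof. by rewrite /nodepoly (bigD1 i). Qed.

Lemma nodepoly_set x i t : nodepoly (set_node x i t) = ('X - t%:P) * nodepoly_but x i.
Proof.
rewrite (nodepolyE _ i) /set_node eqxx; congr (_ * _).
by apply: eq_bigr => j /negbTE ->.
Qed.

Lemma size_nodepoly x : size (nodepoly x) = N.+1.
Proof.
rewrite /nodepoly size_prod_XsubC; congr _.+1.
by rewrite /index_enum -enumT size_enum_ord.
Qed.

Lemma nodepoly_monic x : nodepoly x \is monic.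
Proof. exact: monic_prod_XsubC. Qed.

Lemma size_nodepoly_but x i : size (nodepoly_but x i) = N.
Proof.
have := size_nodepoly x; rewrite (nodepolyE x i) size_monicM ?monicXsubC//.
  by rewrite size_XsubC add2n => -[].
by rewrite monic_neq0//; exact: monic_prod_XsubC.
Qed.

Lemma horner_nodepoly x i : (nodepoly x).[x i] = 0.
Proof. by rewrite (nodepolyE x i) hornerM hornerXsubC subrr mul0r. Qed.

Lemma horner_nodepoly_but x i j : i != j -> (nodepoly_but x i).[x j] = 0.
Proof.
by move=> ij; rewrite /nodepoly_but (bigD1 j) 1?eq_sym//= hornerM hornerXsubC subrr mul0r.
Qed.

Lemma horner_nodepoly_but_neq0 x i : injective x -> (nodepoly_but x i).[x i] != 0.
Proof.
move=> xinj; rewrite horner_prod; apply/prodf_neq0 => j ji.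
by rewrite hornerXsubC subr_eq0; apply: contra_neq ji => /xinj.
Qed.

(** The difference has degree below N and N distinct roots. *)
Lemma lagrange_interpolation x (p : {poly R}) : injective x -> (size p <= N)%N ->
  p = \sum_i (p.[x i] / (nodepoly_but x i).[x i]) *: nodepoly_but x i.
Proof.
move=> xinj pN; apply/eqP; rewrite -subr_eq0; apply/eqP.
apply: (@roots_geq_poly_eq0 _ _ (codom x)); last 2 first.
- by rewrite map_inj_uniq// enum_uniq.
- rewrite size_codom card_ord; apply: (leq_trans (size_polyD _ _)).
  rewrite geq_max pN size_polyN; apply: (leq_trans (size_sum _ _ _)).
  apply/bigmax_leqP => i _; apply: (leq_trans (size_scale_leq _ _)).
  by rewrite size_nodepoly_but.
apply/allP => _ /codomP[i ->]; rewrite rootE hornerD hornerN horner_sum.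
rewrite (bigD1 i)//= hornerZ mulfVK ?horner_nodepoly_but_neq0//.
rewrite big1 ?addr0 ?subrr// => j ji.
by rewrite hornerZ (horner_nodepoly_but _ _ _ ji) mulr0.
Qed.

End NodePolynomials.

(** * Gauss nodes as constrained minimisers *)

Section GaussExistence.
Context {R : realType} {a b : R} {L : (Omega a b -> R) -> R} {N : nat}.
Hypotheses (ab : a < b) (Lpos : positive_linear_functional L) (N0 : (0 < N)%N).
Hypothesis nondeg : forall s : seq (Omega a b), size s = N.-1 -> 0 < polyL L (nodal s ^+ 2).
Implicit Types (p q r : {poly R}) (x : 'I_N -> R) (i j : 'I_N).

Let LD p q : polyL L (p + q) = polyL L p + polyL L q.
Proof. exact: (polyLD ab Lpos). Qed.

Let LB p q : polyL L (p - q) = polyL L p - polyL L q.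
Proof. exact: (polyLB ab Lpos). Qed.

Let LZ c p : polyL L (c *: p) = c * polyL L p.
Proof. exact: (polyLZ ab Lpos). Qed.

Let Lge0 p : (forall t, a <= t <= b -> 0 <= p.[t]) -> 0 <= polyL L p.
Proof. by move=> h; apply: (polyL_ge0 ab Lpos) => z; apply: h; exact: omega_itv. Qed.

Let nodes_in x := forall j, a <= x j <= b.

(** Omitting one index leaves N - 1 points, the size to which [nondeg] applies. *)
Lemma nodepoly_but_gt0 x i : nodes_in x -> 0 < polyL L (nodepoly_but x i ^+ 2).
Proof.
move=> xab; pose s := [seq omega ab (x j) | j <- enum 'I_N & j != i].
have -> : nodepoly_but x i = nodal s.
  rewrite /nodal /s big_map big_filter big_enum_cond/=.
  by apply: eq_bigr => j _; rewrite omegaK.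
apply: nondeg; rewrite size_map -sum1_size big_filter big_enum_cond/= sum1_card.
by rewrite -[in RHS](card_ord N) -(cardC1 i); apply: eq_card => j; rewrite !inE.
Qed.

(** The competitors are node vectors in [a,b]^N instead of all monic polynomials of degree N, so
    real roots in [a,b] come by construction; their orthogonality and distinctness have to be
    derived. *)
Definition minimizer x := nodes_in x /\
  forall y, nodes_in y -> polyL L (nodepoly x ^+ 2) <= polyL L (nodepoly y ^+ 2).

(** The objective is continuous on a compact box, being a combination of moments with coefficients
    continuous in the nodes. It is symmetric in the nodes, so a minimum point may be sorted. *)
Lemma exists_minimizer : exists2 x, minimizer x & {homo x : i j / (i <= j)%N >-> i <= j}.
Proof.
pose A := [set v : 'rV[R]_N | forall j, `[a, b]%classic (v ord0 j)].
pose f (v : 'rV[R]_N) := polyL L (nodepoly (v ord0) ^+ 2).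
have cf : continuous f.
  move=> v.
  have fE u : f u = \sum_(k < (2 * N).+1)
      (nodepoly (u ord0) * nodepoly (u ord0))`_k * L (monomial k).
    rewrite /f (polyLE ab Lpos (2 * N).+1)//.
    rewrite expr2; apply: (leq_trans (size_polyMleq _ _)).
    by rewrite size_nodepoly; lia.
  rewrite (funext fE) /continuous_at.
  have FF : Filter (nbhs v) := nbhs_filter v.
  apply: (@cvg_sumr _ _ _ FF) => k; apply: (@cvgM _ _ _ FF); last exact: cvg_cst.
  by apply: (@coefM_cvg _ _ _ FF) => {}k; apply: (@prod_XsubC_coef_cvg _ _ _ FF) => i;
    exact: coord_continuous.
have [|||v] := @EVT_min_rV R N f A.
- by exists (const_mx a) => j /=; rewrite mxE in_itv/= lexx ltW.
- by apply: (@rV_compact _ _ (fun=> `[a, b]%classic)) => j; exact: segment_compact.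
- exact: continuous_subspaceT.
rewrite inE => vA vmin.
pose s := sort <=%R (codom (v ord0)).
have size_s : size s = N by rewrite size_sort size_codom card_ord.
have sE : nodepoly (fun i : 'I_N => nth 0 s i) = nodepoly (v ord0).
  rewrite /nodepoly -(big_mkord xpredT (fun k : nat => 'X - (nth 0 s k)%:P)) -{1}size_s.
  rewrite -(big_nth 0 xpredT (fun y => 'X - y%:P)) (perm_big (codom (v ord0))).
    by rewrite /codom/= big_image.
  by rewrite perm_sort.
exists (fun i => nth 0 s i).
  split=> [j|y yab].
    have : nth 0 s j \in codom (v ord0) by rewrite -(mem_sort <=%R) mem_nth// size_s.
    by case/codomP => k ->; have := vA k; rewrite /= in_itv.
  rewrite sE; have := vmin (\row_j y j); rewrite inE /f => /(_ _)/le_trans; apply.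
    by move=> j /=; rewrite mxE in_itv/=; exact: yab.
  by rewrite (_ : nodepoly ((\row_j y j) ord0) = nodepoly y)//; apply: eq_bigr => j _; rewrite mxE.
move=> i j ij.
apply: (@sorted_leq_nth _ <=%R le_trans lexx) => //; rewrite ?inE ?size_s//.
exact: (sort_sorted le_total).
Qed.

Section Minimizer.
Variable x : 'I_N -> R.
Hypothesis xmin : minimizer x.

Let xab : nodes_in x. Proof. exact: (proj1 xmin). Qed.

Let set_node_itv y i t : nodes_in y -> a <= t <= b -> nodes_in (set_node y i t).
Proof. by move=> yab tab j; rewrite /set_node; case: eqP. Qed.

(* As a function of its i-th node alone, the minimised quantity is the quadratic
   [A (t - B / A)^2 + const], whose minimum point [B / A] lies in [a, b]. *)
Lemma orthogonal_nodepoly_but i : polyL L (nodepoly x * nodepoly_but x i) = 0.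
Proof.
set q := nodepoly_but x i.
pose A := polyL L (q ^+ 2); pose B := polyL L ('X * q ^+ 2); pose C := polyL L ('X ^+ 2 * q ^+ 2).
have A0 : 0 < A by exact: nodepoly_but_gt0.
have LX t : polyL L (('X - t%:P) * q ^+ 2) = B - t * A.
  by rewrite mulrBl LB mul_polyC LZ.
have LX2 t : polyL L ((('X - t%:P) * q) ^+ 2) = C - 2 * t * B + t ^+ 2 * A.
  have -> : (('X - t%:P) * q) ^+ 2 = 'X ^+ 2 * q ^+ 2 - (2 * t) *: ('X * q ^+ 2) + t ^+ 2 *: q ^+ 2.
    by rewrite -!mul_polyC !polyCM polyC_natr; ring.
  by rewrite LD LB !LZ.
have nonneg t : (forall z, a <= z <= b -> 0 <= z - t) -> 0 <= B - t * A.
  move=> ht; rewrite -LX; apply: Lge0 => z zab.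
  by rewrite hornerM hornerXsubC horner_exp mulr_ge0 ?sqr_ge0 ?ht.
(* B / A is the mean of x under the positive functional p -> L(p q^2); positivity on X - a and on b
   - X places it in [a,b]. *)
have Ba : a * A <= B.
  by rewrite -subr_ge0; apply: nonneg => z /andP[az _]; rewrite subr_ge0.
have bB : B <= b * A.
  rewrite -subr_ge0 -opprB -LX -mulN1r -LZ; apply: Lge0 => z /andP[_ zb].
  rewrite hornerZ hornerM hornerXsubC horner_exp mulN1r -mulNr opprB.
  by rewrite mulr_ge0 ?sqr_ge0// subr_ge0.
have cab : a <= B / A <= b by rewrite ler_pdivlMr// ler_pdivrMr// Ba.
have := proj2 xmin _ (set_node_itv _ i _ xab cab).
rewrite nodepoly_set (nodepolyE x i) -/q !LX2.
move=> h; have BA : B = B / A * A by rewrite divfK// gt_eqF.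
move: (B / A) BA h => c BA; rewrite BA => h.
have : A * (x i - c) ^+ 2 <= 0.
  rewrite (_ : _ * _ = (C - 2 * x i * (c * A) + x i ^+ 2 * A) -
     (C - 2 * c * (c * A) + c ^+ 2 * A)); last ring.
  by rewrite subr_le0.
rewrite pmulr_rle0// => h2; have xc : x i = c.
  by apply/eqP; rewrite -subr_eq0 -sqrf_eq0 eq_le h2 sqr_ge0.
by rewrite -mulrA -expr2 LX BA xc subrr.
Qed.

(** The second moment of g is controlled by e times the first plus 1/e times the third. As the third
    is 0, e -> 0 leaves nothing. It is applied to the distance g from an end point of [a,b]. *)
Lemma cubic_vanish g r : (forall z, a <= z <= b -> 0 <= g.[z]) ->
  polyL L (g ^+ 3 * r ^+ 2) = 0 -> polyL L (g ^+ 2 * r ^+ 2) <= 0.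
Proof.
move=> g0 g3; set M := polyL L _; pose K := polyL L (g * r ^+ 2).
have K0 : 0 <= K.
  by apply: Lge0 => z zab; rewrite hornerM horner_exp mulr_ge0 ?sqr_ge0 ?g0.
have bound e : 0 < e -> M <= e * K.
  move=> e0; have -> : e * K = polyL L (e *: (g * r ^+ 2) + e^-1 *: (g ^+ 3 * r ^+ 2)).
    by rewrite LD !LZ g3 mulr0 addr0.
  rewrite -subr_ge0 -LB; apply: Lge0 => z /g0 gz.
  rewrite hornerD hornerN hornerD !hornerZ (hornerM g (r ^+ 2)).
  rewrite !(hornerM (_ ^+ _) (_ ^+ _)) !horner_exp; set y := g.[z] in gz *.
  (* [y^2 <= e y + y^3 / e] for [y >= 0], the discriminant of [e^2 - e y + y^2] being negative. *)
  have -> : e * (y * r.[z] ^+ 2) + e^-1 * (y ^+ 3 * r.[z] ^+ 2) - y ^+ 2 * r.[z] ^+ 2 =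
    (y / e * ((e - y / 2) ^+ 2 + 3 / 4 * y ^+ 2)) * r.[z] ^+ 2.
    by field; rewrite gt_eqF.
  rewrite mulr_ge0 ?sqr_ge0// mulr_ge0 ?divr_ge0 ?(ltW e0)//.
  by rewrite addr_ge0 ?sqr_ge0// mulr_ge0 ?sqr_ge0// divr_ge0.
rewrite leNgt; apply/negP => M0.
have K1 : 0 < K + 1 by rewrite ltr_wpDl.
(* This e gives M (K + 1) <= M K, impossible for M > 0. *)
have := bound (M / (K + 1)) (divr_gt0 M0 K1).
rewrite mulrAC ler_pdivlMr//; apply/negP; rewrite -ltNge ltr_pM2l//; lra.
Qed.

(* An interior double node t could be split into t - e and t + e, which lowers the minimised
   quantity; at an end point, orthogonality makes a cubic moment vanish. *)
Lemma minimizer_inj : injective x.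
Proof.
move=> i j xij; apply/eqP; apply/negP => /negP ij.
pose r := \prod_(k | (k != i) && (k != j)) ('X - (x k)%:P).
have but_i : nodepoly_but x i = ('X - (x j)%:P) * r.
  by rewrite /nodepoly_but (bigD1 j) 1?eq_sym.
pose t := x i; have tE : x j = t by rewrite -xij.
have full : nodepoly x = ('X - t%:P) ^+ 2 * r.
  by rewrite (nodepolyE x i) but_i tE expr2 mulrA.
have M0 : 0 < polyL L (('X - t%:P) ^+ 2 * r ^+ 2).
  by rewrite -exprMn -tE -but_i nodepoly_but_gt0.
(* Orthogonality of (X - t)^2 r to (X - t) r, the polynomial without node i. *)
have first : polyL L (('X - t%:P) ^+ 3 * r ^+ 2) = 0.
  rewrite -(orthogonal_nodepoly_but i) full but_i tE; congr polyL; ring.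
have /andP[ta tb] := xab i; rewrite -/t in ta tb.
have [at_|ta'] := eqVneq a t.
  have : polyL L (('X - t%:P) ^+ 2 * r ^+ 2) <= 0.
    apply: cubic_vanish first => z /andP[az _].
    by rewrite hornerXsubC -at_ subr_ge0.
  by rewrite leNgt M0.
have [bt_|tb'] := eqVneq b t.
  have : polyL L ((- ('X - t%:P)) ^+ 2 * r ^+ 2) <= 0.
    apply: cubic_vanish => [z /andP[_ zb]|].
      by rewrite hornerN hornerXsubC -bt_ opprB subr_ge0.
    have -> : (- ('X - t%:P)) ^+ 3 * r ^+ 2 = -1 *: (('X - t%:P) ^+ 3 * r ^+ 2).
      by rewrite scaleN1r; ring.
    by rewrite LZ first mulr0.
  by rewrite sqrrN leNgt M0.
have {ta'}ta' : a < t by rewrite lt_neqAle ta'.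
have {tb'}tb' : t < b by rewrite lt_neqAle eq_sym tb'.
set M := polyL L _ in M0; pose K := polyL L (r ^+ 2).
have K0 : 0 <= K by exact: polyL_sqr_ge0.
(* The first two bounds keep t - e and t + e in [a,b]; the last two make e^2 K smaller than 2 M. *)
pose e := Num.min (Num.min (t - a) (b - t)) (Num.min 1 (M / (K + 1))).
have K1 : 0 < K + 1 by rewrite ltr_wpDl.
have e0 : 0 < e by rewrite !lt_min !subr_gt0 ta' tb' ltr01 divr_gt0.
have [[e1 e2] [e3 e4]] : ((e <= t - a) /\ (e <= b - t)) /\ ((e <= 1) /\ (e <= M / (K + 1))).
  by rewrite !ge_min !lexx ?orbT.
pose y := set_node (set_node x i (t - e)) j (t + e).
have yab : nodes_in y.
  apply: set_node_itv; last by apply/andP; split; lra.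
  by apply: set_node_itv => //; apply/andP; split; lra.
have := proj2 xmin y yab.
(* Splitting the double node replaces (X - t)^2 by (X - t)^2 - e^2. *)
have -> : nodepoly y = nodepoly x - e ^+ 2 *: r.
  rewrite /y nodepoly_set /nodepoly_but (bigD1 i)//= {1}/set_node eqxx.
  rewrite (eq_bigr (fun k => 'X - (x k)%:P)); last first.
    by move=> k /andP[_ /negbTE]; rewrite /set_node => ->.
  rewrite (eq_bigl (fun k => (k != i) && (k != j))); last by move=> k; rewrite andbC.
  rewrite -/r full -mul_polyC polyCD polyCB rmorphXn/=; ring.
have -> : (nodepoly x - e ^+ 2 *: r) ^+ 2 =
    nodepoly x ^+ 2 - (2 * e ^+ 2) *: (('X - t%:P) ^+ 2 * r ^+ 2) + (e ^+ 4) *: (r ^+ 2).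
  by rewrite full -!mul_polyC !polyCM polyC_natr; ring.
rewrite LD LB !LZ -/M -/K => h.
(* Minimality asks for 2 M <= e^2 K, whereas e^2 K <= e K < M. *)
have h2 : e ^+ 2 * (2 * M) <= e ^+ 2 * (e ^+ 2 * K) by lra.
move: h2; rewrite ler_pM2l ?exprn_gt0// leNgt => /negP; apply.
have eK : e * (K + 1) <= M by rewrite -ler_pdivlMr.
have : e ^+ 2 * K <= e * K by rewrite ler_wpM2r// expr2 ler_piMl// ltW.
lra.
Qed.

End Minimizer.

(** The weights are the interpolatory ones, exact below degree N. Division by the node polynomial,
    which is orthogonal to all degrees below N, extends exactness to degree 2N - 1. Testing on the
    squares of [nodepoly_but] shows that the weights are positive. *)
Theorem gauss_exists : exists (x w : 'I_N -> R),
  [/\ forall j, a <= x j <= b, {homo x : i j / (i < j)%N >-> i < j},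
      forall i, 0 < w i &
      forall p, (size p <= 2 * N)%N -> polyL L p = \sum_i w i * p.[x i]].
Proof.
have [x xmin xhomo] := exists_minimizer.
have xinj := minimizer_inj _ xmin.
pose c i := (nodepoly_but x i).[x i].
have c0 i : c i != 0 by exact: horner_nodepoly_but_neq0.
pose w i := polyL L (nodepoly_but x i) / c i.
have Lint p : (size p <= N)%N -> polyL L p = \sum_i w i * p.[x i].
  move=> pN; rewrite {1}(lagrange_interpolation x p xinj pN) (polyL_sum ab Lpos).
  by apply: eq_bigr => i _; rewrite LZ /w -/(c i); ring.
have Lorth p : (size p <= N)%N -> polyL L (p * nodepoly x) = 0.
  move=> pN; rewrite (lagrange_interpolation x p xinj pN) mulr_suml (polyL_sum ab Lpos).
  rewrite big1// => i _; rewrite -scalerAl LZ mulrC [_ * nodepoly x]mulrC.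
  by rewrite orthogonal_nodepoly_but// mul0r.
have exact_rule p : (size p <= 2 * N)%N -> polyL L p = \sum_i w i * p.[x i].
  move=> pN; have f0 : nodepoly x != 0 by rewrite monic_neq0// nodepoly_monic.
  rewrite {1}(divp_eq p (nodepoly x)) LD Lorth; last first.
    by rewrite size_divp// size_nodepoly leq_subLR addnn -mul2n.
  rewrite add0r Lint; last by have := ltn_modp p (nodepoly x); rewrite f0 size_nodepoly ltnS.
  apply: eq_bigr => i _; rewrite {2}(divp_eq p (nodepoly x)).
  by rewrite hornerD hornerM horner_nodepoly mulr0 add0r.
exists x, w; split => //.
- exact: (proj1 xmin).
- move=> i j ij; rewrite lt_neqAle xhomo 1?ltnW// andbT.
  by apply: contraTneq ij => /xinj ->; rewrite ltnn.
move=> i; have := nodepoly_but_gt0 x i (proj1 xmin).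
rewrite exact_rule; last first.
  rewrite expr2; apply: (leq_trans (size_polyMleq _ _)); rewrite size_nodepoly_but; lia.
rewrite (bigD1 i)//= big1; last first.
  by move=> j ji; rewrite horner_exp horner_nodepoly_but 1?eq_sym// expr0n mulr0.
by rewrite addr0 horner_exp pmulr_lgt0// lt_def sqr_ge0 sqrf_eq0 -/(c i) c0.
Qed.

End GaussExistence.

(** * Convergence of nodes and weights *)

Section StrictlyMonotone.

Lemma strict_mono_ge_id {N : nat} (f : 'I_N -> 'I_N) :
  (forall i j : 'I_N, (i < j)%N -> (f i < f j)%N) -> forall i : 'I_N, (i <= f i)%N.
Proof.
move=> fmono [k kN] /=; elim: k kN => // k IH kN.
have kN' := ltnW kN; apply: (leq_ltn_trans (IH kN')).
exact: fmono.
Qed.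

(** Conjugating f with the order reversal turns the bound i <= f i into f i <= i. This matches
    approximating nodes with Gauss nodes index by index. *)
Lemma strict_mono_id {N : nat} (f : 'I_N -> 'I_N) :
  (forall i j : 'I_N, (i < j)%N -> (f i < f j)%N) -> forall i : 'I_N, f i = i.
Proof.
move=> fmono i; apply: val_inj; apply/eqP; rewrite eqn_leq (strict_mono_ge_id f fmono) andbT.
have gmono (j k : 'I_N) : (j < k)%N -> (rev_ord (f (rev_ord j)) < rev_ord (f (rev_ord k)))%N.
  move=> jk /=; have := fmono (rev_ord k) (rev_ord j) => /=.
  have := ltn_ord k; have := ltn_ord j.
  have := ltn_ord (f (rev_ord k)); have := ltn_ord (f (rev_ord j)) => ? ? ? ? h.
  have {}h := h _; lia.
have := strict_mono_ge_id (fun j => rev_ord (f (rev_ord j))) gmono (rev_ord i); rewrite /= rev_ordK.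
have := ltn_ord i; have := ltn_ord (f i); lia.
Qed.

End StrictlyMonotone.

Section BoundedCoefficients.
Context {R : realType} {T : Type}.
Implicit Types G : T -> {poly R}.

(** Convergence of moments carries over to polynomials that vary with t when their coefficients stay
    bounded. *)
Definition bounded_coef G := forall k, exists C, forall t, `|(G t)`_k| <= C.

Lemma bounded_coefM G1 G2 : bounded_coef G1 -> bounded_coef G2 ->
  bounded_coef (fun t => G1 t * G2 t).
Proof.
move=> /choice[C1 h1] /choice[C2 h2] k; exists (\sum_(j < k.+1) C1 j * C2 (k - j)%N) => t.
rewrite coefM; apply: (le_trans (ler_norm_sum _ _ _)); apply: ler_sum => j _.
by rewrite normrM ler_pM.
Qed.

Lemma bounded_coefB G1 G2 : bounded_coef G1 -> bounded_coef G2 ->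
  bounded_coef (fun t => G1 t - G2 t).
Proof.
move=> h1 h2 k; have [C1 hC1] := h1 k; have [C2 hC2] := h2 k.
exists (C1 + C2) => t; rewrite coefB; apply: (le_trans (ler_normB _ _)).
exact: lerD.
Qed.

Lemma bounded_coef_cst p : bounded_coef (fun=> p).
Proof. by move=> k; exists `|p`_k|. Qed.

Lemma bounded_coef_prod (I : Type) (r : seq I) (x : T -> I -> R) B :
  (forall t i, `|x t i| <= B) ->
  bounded_coef (fun t => \prod_(i <- r) ('X - (x t i)%:P)).
Proof.
move=> xB; elim: r => [|i r IH].
  by move=> k; exists `|(1 : {poly R})`_k| => t; rewrite big_nil.
have h : bounded_coef (fun t => 'X - (x t i)%:P).
  apply: bounded_coefB; first exact: bounded_coef_cst.
  move=> k; exists B => t; rewrite coefC; case: (k == 0)%N; first exact: xB.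
  by rewrite normr0; apply: le_trans (xB t i).
move=> k; have [C hC] := bounded_coefM _ _ h IH k.
by exists C => t; rewrite big_cons.
Qed.

End BoundedCoefficients.

(** * Rules with converging moments, along an arbitrary filter *)

Section GaussLimit.
Context {R : realType} {a b : R} {L : (Omega a b -> R) -> R} {N : nat}.
Hypotheses (ab : a < b) (Lpos : positive_linear_functional L) (N0 : (0 < N)%N).
Implicit Types i j : 'I_N.
Variables (x w : 'I_N -> R).
Hypotheses (xmono : {homo x : i j / (i < j)%N >-> i < j}) (w0 : forall i, 0 < w i)
  (gauss : forall p : {poly R}, (size p <= 2 * N)%N -> polyL L p = \sum_i w i * p.[x i]).
Context {T : Type} {F : set_system T} {FF : ProperFilter F}.
Variables (y v : T -> 'I_N -> R).
Hypotheses (yab : forall t j, a <= y t j <= b)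
  (yasc : \forall t \near F, {homo y t : i j / (i <= j)%N >-> i <= j})
  (moments : forall k, (k < 2 * N)%N ->
     \sum_j v t j * y t j ^+ k @[t --> F] --> L (monomial k)).

Let rule t (p : {poly R}) : R := \sum_j v t j * p.[y t j].

Let momE t (p : {poly R}) : (size p <= 2 * N)%N ->
  rule t p = \sum_(k < 2 * N) p`_k * \sum_j v t j * y t j ^+ k.
Proof.
move=> pN; rewrite /rule (eq_bigr (fun j => \sum_(k < 2 * N) p`_k * (v t j * y t j ^+ k))).
  by rewrite exchange_big/=; apply: eq_bigr => k _; rewrite mulr_sumr.
move=> j _; rewrite (horner_coef_wide _ pN) mulr_sumr; apply: eq_bigr => k _.
by rewrite mulrCA.
Qed.

Let xinj : injective x.
Proof.
move=> i j xij; apply: val_inj; case: (ltngtP i j) => // /xmono; by rewrite xij ltxx.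
Qed.

Lemma cvg0_mul_bounded (f g : T -> R) C : (forall t, `|f t| <= C) ->
  g t @[t --> F] --> 0 -> f t * g t @[t --> F] --> 0.
Proof.
move=> fC g0; apply/cvgr0Pnorm_le => e e0.
have C1 : 0 < `|C| + 1 by rewrite ltr_wpDl.
move/cvgr0Pnorm_le : g0 => /(_ (e / (`|C| + 1)) (divr_gt0 e0 C1)).
apply: filterS => t; rewrite ler_pdivlMr// normrM => h.
apply: le_trans h; rewrite mulrC ler_wpM2l//.
by apply: (le_trans (fC t)); apply: (le_trans (ler_norm C)); rewrite lerDl.
Qed.

Lemma rule_close (G : T -> {poly R}) : bounded_coef G ->
  (forall t, (size (G t) <= 2 * N)%N) -> polyL L (G t) - rule t (G t) @[t --> F] --> 0.
Proof.
move=> Gb GN.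
have -> : (fun t => polyL L (G t) - rule t (G t)) =
   (fun t => \sum_(k < 2 * N) (G t)`_k * (L (monomial k) - \sum_j v t j * y t j ^+ k)).
  apply/funext => t; rewrite momE// (polyLE ab Lpos (2 * N))// -sumrB.
  by apply: eq_bigr => k _; rewrite mulrBr.
have lim0 : \sum_(k < 2 * N) (0 : R) = 0 by rewrite big1.
rewrite -[X in _ --> X]lim0; apply: cvg_sumr => k; have [C hC] := Gb k.
apply: (cvg0_mul_bounded _ _ C) => //; rewrite -[X in _ --> X](subrr (L (monomial k))).
by apply: cvgB; [exact: cvg_cst|exact: (moments _ (ltn_ord k))].
Qed.

Let p t := nodepoly (y t).

Let rule_p t (q : {poly R}) : rule t (p t * q) = 0.
Proof. by rewrite /rule big1// => j _; rewrite hornerM horner_nodepoly mul0r mulr0. Qed.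

Let size_diff t : (size (p t - nodepoly x)%R <= N)%N.
Proof.
apply/leq_sizeP => j; rewrite leq_eqVlt => /orP[/eqP <-|jN].
  have := nodepoly_monic (y t); have := nodepoly_monic x.
  by rewrite !monicE !lead_coefE !size_nodepoly/= coefB => /eqP -> /eqP ->; rewrite subrr.
by rewrite coefB !nth_default ?subrr// size_nodepoly.
Qed.

Let bounded_p : bounded_coef p.
Proof.
apply: (bounded_coef_prod _ _ _ (`|a| + `|b|)) => t j; have /andP[ay yb] := yab t j.
rewrite ler_norml; have := ler_norm b; have := ler_norm (- a); rewrite normrN.
have := normr_ge0 a; have := normr_ge0 b => *; apply/andP; split; lra.
Qed.

(** Let d = p - p_G, of degree below N as both are monic. The rule at t kills p d, so L(p d) -> 0.
    By Gauss exactness L(p_G d) = 0, hence L(p d) = L(d^2), which is the sum since p_G vanishes at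
    each x_i. *)
Lemma nodepoly_at_gauss : \sum_i w i * (p t).[x i] ^+ 2 @[t --> F] --> 0.
Proof.
pose d t := p t - nodepoly x.
have sz2 t : (size (p t * d t)%R <= 2 * N)%N.
  apply: (leq_trans (size_polyMleq _ _)); rewrite size_nodepoly.
  by have := size_diff t; rewrite /d; lia.
have bd : bounded_coef (fun t => p t * d t).
  by apply: bounded_coefM => //; apply: bounded_coefB => //; exact: bounded_coef_cst.
suff -> : (fun t => \sum_i w i * (p t).[x i] ^+ 2) =
    (fun t => polyL L (p t * d t) - rule t (p t * d t)) by exact: rule_close.
apply/funext => t; symmetry.
rewrite rule_p subr0.
have -> : p t * d t = d t ^+ 2 + nodepoly x * d t by rewrite /d; ring.
have szd : (size (nodepoly x * d t)%R <= 2 * N)%N.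
  apply: (leq_trans (size_polyMleq _ _)); rewrite size_nodepoly.
  by have := size_diff t; rewrite /d; lia.
have szd2 : (size (d t ^+ 2)%R <= 2 * N)%N.
  rewrite expr2; apply: (leq_trans (size_polyMleq _ _)).
  by have := size_diff t; rewrite /d; lia.
rewrite (polyLD ab Lpos) (gauss _ szd2) (gauss _ szd) [X in _ + X]big1 ?addr0.
  apply: eq_bigr => i _; rewrite /d horner_exp hornerD hornerN horner_nodepoly.
  by rewrite subr0.
by move=> i _; rewrite hornerM horner_nodepoly mul0r mulr0.
Qed.

(** The least distance between Gauss nodes, capped at 1, which is its value for N = 1. *)
Let gap := \big[Num.min/1]_(q : 'I_N * 'I_N | (q.1 < q.2)%N) (x q.2 - x q.1).

Let gap_gt0 : 0 < gap.
Proof. by apply: lt_bigmin => // q q12; rewrite subr_gt0 xmono. Qed.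

Let gap_le i j : (i < j)%N -> gap <= x j - x i.
Proof. by move=> ij; rewrite /gap; 
  exact: (@bigmin_le_cond _ _ _ 1 (i, j) (fun q => (q.1 < q.2)%N) (fun q => x q.2 - x q.1) ij). Qed.

(** If all nodes stayed at distance e from x_j, then |p(x_j)| >= e^N, against [nodepoly_at_gauss]
    and w_j > 0. So each x_j has a node f(j) within e; for e at most half the gap, the ascending
    order makes f strictly increasing, hence the identity. *)
Theorem nodes_cvg i : y t i @[t --> F] --> x i.
Proof.
apply/cvgrPdist_lt => e0 e0_gt0; pose e := Num.min e0 (gap / 2).
have e_gt0 : 0 < e by rewrite lt_min e0_gt0 divr_gt0.
have e_gap : e <= gap / 2 by rewrite ge_min lexx orbT.
have small j : \forall t \near F, `|(p t).[x j]| < e ^+ N.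
  have pos : 0 < w j * e ^+ N ^+ 2 by rewrite mulr_gt0 ?exprn_gt0.
  have /cvgr0Pnorm_lt/(_ _ pos) := nodepoly_at_gauss.
  apply: filterS => t; move/(le_lt_trans (ler_norm _)).
  rewrite (bigD1 j)//= => h.
  have : w j * (p t).[x j] ^+ 2 < w j * e ^+ N ^+ 2.
    apply: le_lt_trans h; rewrite lerDl sumr_ge0// => k _.
    by rewrite mulr_ge0 ?sqr_ge0// ltW.
  rewrite ltr_pM2l// -[(p t).[_] ^+ 2]real_normK ?num_real// ltr_pXn2r// ?nnegrE//.
  by rewrite exprn_ge0// ltW.
have smalls : \forall t \near F, forall j, `|(p t).[x j]| < e ^+ N by exact: filter_forall.
near=> t; have asc : {homo y t : i j / (i <= j)%N >-> i <= j} by near: t.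
have st j : `|(p t).[x j]| < e ^+ N by move: j; near: t.
have ex j : exists k, `|x j - y t k| < e.
  apply: contrapT => /forallNP far; have := st j; apply/negP; rewrite -leNgt.
  rewrite /p /nodepoly horner_prod normr_prod -[X in e ^+ X](card_ord N) -prodr_const.
  apply: ler_prod => k _; rewrite hornerXsubC (ltW e_gt0) leNgt; exact/negP/far.
have [f fE] := choice ex.
have fmono j (k : 'I_N) : (j < k)%N -> (f j < f k)%N.
  move=> jk; rewrite ltnNge; apply/negP => /asc; apply/negP; rewrite -ltNge.
  have := gap_le _ _ jk; have := fE j; have := fE k; rewrite !ltr_norml => /andP[? ?] /andP[? ?] ?.
  lra.
have := fE i; rewrite (strict_mono_id f fmono) => /lt_le_trans; apply.
by rewrite ge_min lexx.
Unshelve. all: by end_near. Qed.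

(** The polynomial q vanishing at all nodes but the i-th isolates the weight: the rule gives v_i
    q(y_i), whose limit is w_i q0(x_i), and q0(x_i) is nonzero. *)
Theorem weights_cvg i : v t i @[t --> F] --> w i.
Proof.
pose q t := nodepoly_but (y t) i; pose q0 := nodepoly_but x i.
have qc k : (q t)`_k @[t --> F] --> q0`_k by apply: prod_XsubC_coef_cvg => j; exact: nodes_cvg.
have sq t : (size (q t) <= 2 * N)%N by rewrite size_nodepoly_but; lia.
have sq0 : (size q0 <= 2 * N)%N by rewrite size_nodepoly_but; lia.
have horner_cvg z z0 : z t @[t --> F] --> z0 -> (q t).[z t] @[t --> F] --> q0.[z0].
  move=> zz0; rewrite (horner_coef_wide _ sq0).
  under eq_fun do rewrite (horner_coef_wide _ (sq _)).
  apply: cvg_sumr => k; apply: cvgM; first exact: qc.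
  elim: (k : nat) => [|n IH]; first by under eq_fun do rewrite expr0; exact: cvg_cst.
  by under eq_fun do rewrite exprS; rewrite exprS; exact: cvgM.
have qi : (q t).[y t i] @[t --> F] --> q0.[x i] by apply: horner_cvg; exact: nodes_cvg.
have q00 : q0.[x i] != 0 by exact: horner_nodepoly_but_neq0.
have rE t : rule t (q t) = v t i * (q t).[y t i].
  rewrite /rule (bigD1 i)//= big1 ?addr0// => j ji.
  by rewrite horner_nodepoly_but 1?eq_sym// mulr0.
have Lq0 : polyL L q0 = w i * q0.[x i].
  rewrite (gauss _ sq0) (bigD1 i)//= big1 ?addr0// => j ji.
  by rewrite horner_nodepoly_but 1?eq_sym// mulr0.
have rc : rule t (q t) @[t --> F] --> polyL L q0.
  rewrite (polyLE ab Lpos (2 * N))//; under eq_fun do rewrite momE//.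
  by apply: cvg_sumr => k; apply: cvgM; [exact: qc|exact: (moments _ (ltn_ord k))].
have : rule t (q t) / (q t).[y t i] @[t --> F] --> w i.
  rewrite -[w i](mulfK q00) -Lq0; apply: cvgM => //; exact: cvgV.
(* The quotient equals the weight once q(y_i) is nonzero, which holds eventually. *)
apply: cvg_trans; apply: near_eq_cvg.
have nz : \forall t \near F, (q t).[y t i] != 0 by exact: (cvgr_neq0 _ qi).
by apply: filterS nz => t qt; rewrite rE mulfK.
Qed.

End GaussLimit.

(** * The limit of large length-scale *)

Section FlatLimit.
Context {R : realType} {a b : R} {L : (Omega a b -> R) -> R} {N : nat}.
Hypotheses (ab : a < b) (Lpos : positive_linear_functional L).

Lemma optimal_le (ell : R) H (X X' : 'rV[Omega a b]_N) (w w' : 'rV[R]_N) :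
  0 < ell -> is_rkhs (gauss_kernel ell) H -> optimal_rule L H X w ->
  worst_case_error L H X w <= worst_case_error L H X' w'.
Proof.
move=> l0 KH [_ ->]; apply: ge_inf; last by exists (X', w').
by exists 0 => _ [p _ <-]; exact: (wce_ge0 Lpos p.1 p.2 ell H l0 KH).
Qed.

(** By 1 - e^(-u) <= u with u = x^2 / (2 ell^2), the difference is O(ell^(-2)); for ell >= 1 the
    rate 1/ell follows and is sufficient. *)
Lemma kfeature_flat k : exists2 D : R, 0 <= D &
  forall ell : R, 1 <= ell -> `|L (monomial k) - L (kfeature ell k)| <= D / ell.
Proof.
pose B := `|a| + `|b|.
have xB (x : Omega a b) : `|val x| <= B.
  have /andP[ax xb] := omega_itv x; rewrite ler_norml /B.
  have := ler_norm b; have := ler_norm (- a); rewrite normrN.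
  have := normr_ge0 a; have := normr_ge0 b => *; apply/andP; split; lra.
have B0 : 0 <= B by rewrite addr_ge0.
have BB0 : 0 <= B ^+ k * B ^+ 2 by rewrite mulr_ge0 ?exprn_ge0.
exists (B ^+ k * B ^+ 2 * tmass L) => [|ell l1].
  by rewrite mulr_ge0// (tmass_ge0 Lpos).
have l0 : 0 < ell by exact: lt_le_trans l1.
have ck : continuous (kfeature ell k : Omega a b -> R).
  exact: (lip_cont _ (ex_lip_kfeature ab ell k)).
have cm : continuous (monomial k : Omega a b -> R).
  exact: (lip_cont _ (ex_lip_monomial ab k)).
rewrite -(functB Lpos)// mulrAC; apply: (norm_funct_le Lpos); first exact: contB.
move=> x; rewrite /kfeature /monomial -{1}[_ ^+ k]mulr1 -mulrBr normrM normrX.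
rewrite -(mulrA (B ^+ k)) ler_pM ?exprn_ge0//.
  by apply: lerXn2r; rewrite ?nnegrE.
set u := val x ^+ 2 / (2 * ell ^+ 2).
have u0 : 0 <= u by rewrite divr_ge0 ?sqr_ge0// mulr_ge0// sqr_ge0.
have := expR_ge1Dx (- u); have e1 : expR (- u) <= 1 by rewrite -expR0 ler_expR oppr_le0.
rewrite ger0_norm ?subr_ge0// => e2; apply: (@le_trans _ _ u); first lra.
rewrite /u ler_pM ?sqr_ge0 ?invr_ge0 ?mulr_ge0 ?(ltW l0)//.
  by rewrite -[leLHS](real_normK (num_real _)); apply: lerXn2r; rewrite ?nnegrE.
rewrite lef_pV2 ?posrE ?mulr_gt0 ?exprn_gt0//.
by rewrite expr2; have : ell <= ell * ell; [rewrite ler_peMr// ltW|lra].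
Qed.

Lemma inv_cvg0_pinfty : ell^-1 @[ell --> +oo] --> (0 : R).
Proof.
apply/cvgr0Pnorm_le => e e0.
have : \forall ell \near (+oo : set_system R), e^-1 <= ell by exact: nbhs_pinfty_ge (num_real _).
apply: filterS => ell h; have ell0 : 0 < ell by apply: lt_le_trans h; rewrite invr_gt0.
by rewrite ger0_norm ?invr_ge0 ?(ltW ell0)// -[e]invrK lef_pV2 ?posrE// invr_gt0.
Qed.

(** The topology of [Omega a b] is the initial one for [val], so its open sets are preimages of open
    sets of reals. *)
Lemma omega_cvg (T : Type) (F : set_system T) (FF : Filter F) (f : T -> Omega a b) (x : Omega a b) :
  val (f t) @[t --> F] --> val x -> f t @[t --> F] --> x.
Proof.
move=> fx A [B [[C Cop <-] Cx sBA]].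
have FC : F [set t | C (val (f t))] by apply: fx; exact: open_nbhs_nbhs.
by apply: (@filterS _ F _ _ _ _ FC) => t Ct; exact: sBA.
Qed.

Lemma row_cvg {S : topologicalType} (T : Type) (F : set_system T) (FF : Filter F)
    (f : T -> 'rV[S]_N) (v : 'rV[S]_N) :
  (forall j, f t ord0 j @[t --> F] --> v ord0 j) -> f t @[t --> F] --> v.
Proof.
move=> fv A [P vP sPA].
have : \forall t \near F, forall j, P ord0 j (f t ord0 j).
  by apply: filter_forall => j; apply: fv; exact: vP.
move=> FP; apply: (@filterS _ F _ _ _ _ FP) => t Pt.
by apply: sPA => i j; rewrite ord1.
Qed.

End FlatLimit.

Theorem theorem3p4 (R : realType) (a b : R) (L : (Omega a b -> R) -> R)
    (N : nat) (H : R -> hilbertFunSpace R (Omega a b))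
    (Xopt : R -> 'rV[Omega a b]_N) (wopt : R -> 'rV[R]_N) :
  a < b ->
  (1 <= N)%N ->
  positive_linear_functional L ->
  (forall ell : R, 0 < ell -> is_rkhs (gauss_kernel ell) (H ell)) ->
  (forall ell : R, 0 < ell ->
     is_the_unique_rule (optimal_rule L (H ell)) (Xopt ell) (wopt ell)) ->
  (exists (XG : 'rV[Omega a b]_N) (wG : 'rV[R]_N),
     [/\ is_the_unique_rule (gaussian_quadrature L) XG wG,
         Xopt ell @[ell --> +oo] --> XG &
         wopt ell @[ell --> +oo] --> wG]) /\
  (exists2 C : R, 0 < C & \forall ell \near +oo,
     `|worst_case_error L (H ell) (Xopt ell) (wopt ell)|
       <= C * `|ell ^- (2 * N)|).
Proof.
move=> ab N0 Lpos KH opt.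
(* The conclusion does not involve ell, so it is derived at ell = 1. *)
have nondeg := unique_optimal_nondegenerate ab Lpos ltr01 (KH 1 ltr01) (opt 1 ltr01).
have [|x [w [xab xmono w0 gauss]]] := gauss_exists ab Lpos N0; first by move=> s sN; exact: nondeg.
pose XG : 'rV[Omega a b]_N := \row_i omega ab (x i).
pose wG : 'rV[R]_N := \row_i w i.
have exactG k : (k <= 2 * N - 1)%N -> quad XG wG (monomial k) = L (monomial k).
  move=> kN; transitivity (polyL L 'X^k).
    rewrite gauss; last by rewrite size_polyXn; lia.
    by apply: eq_bigr => i _; rewrite !mxE /monomial omegaK// hornerXn.
  by congr L; apply/funext => z; rewrite hornerXn.
have ascG : ascending XG.
  move=> i j; rewrite !mxE !omegaK// leq_eqVlt => /orP[/eqP/val_inj ->//|/xmono/ltW//].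
have [C C0 hC] := wce_exact_rule ab Lpos XG wG N0 exactG.
have wce_opt ell : 1 <= ell ->
    0 <= worst_case_error L (H ell) (Xopt ell) (wopt ell) <= C * ell ^- (2 * N).
  move=> l1; have l0 : 0 < ell by exact: lt_le_trans l1.
  rewrite (wce_ge0 Lpos _ _ _ _ l0 (KH _ l0))/=.
  apply: le_trans (hC ell (H ell) l1 (KH _ l0)).
  exact: (optimal_le Lpos _ _ _ _ _ _ l0 (KH _ l0) (proj1 (opt _ l0))).
have near1 : \forall ell \near (+oo : set_system R), 1 <= ell by exact: nbhs_pinfty_ge (num_real _).
split; last first.
  exists C => //; apply: filterS near1 => ell l1; have /andP[e0 e1] := wce_opt ell l1.
  by rewrite ger0_norm// (le_trans e1)// ler_wpM2l ?(ltW C0)// ler_norm.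
pose y ell i := val (Xopt ell ord0 i).
(* Absorbing the exponential into the weights turns the rule on [kfeature] into a rule on
   monomials. *)
pose v ell i := wopt ell ord0 i * expR (- (y ell i ^+ 2 / (2 * ell ^+ 2))).
have yab ell j : a <= y ell j <= b by exact: omega_itv.
have yasc : \forall ell \near (+oo : set_system R),
    forall i j : 'I_N, (i <= j)%N -> y ell i <= y ell j.
  apply: filterS near1 => ell l1; have l0 : 0 < ell by exact: lt_le_trans l1.
  exact: (proj1 (proj1 (opt _ l0))).
have quadE ell k : \sum_j v ell j * y ell j ^+ k = quad (Xopt ell) (wopt ell) (kfeature ell k).
  by apply: eq_bigr => j _; rewrite /v /kfeature -mulrA [expR _ * _]mulrC.
have moments k : (k < 2 * N)%N ->
    \sum_j v ell j * y ell j ^+ k @[ell --> +oo] --> L (monomial k).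
  move=> kN; have [D D0 hD] := kfeature_flat ab Lpos k.
  (* The error k! ell^k e(Q) is at most k! C ell^(k-2N), and k < 2N leaves at least one factor
     1/ell. *)
  have close ell : 1 <= ell -> `|L (monomial k) - \sum_j v ell j * y ell j ^+ k| <=
      (D + k`!%:R * C) * ell^-1.
    move=> l1; have l0 : 0 < ell by exact: lt_le_trans l1.
    rewrite quadE -(subrK (L (kfeature ell k)) (L (monomial k))) -addrA mulrDl.
    apply: (le_trans (ler_normD _ _)); apply: lerD; first exact: hD.
    apply: (le_trans (wce_kfeature ab Lpos _ _ _ _ l0 (KH _ l0) k)).
    rewrite -!mulrA ler_wpM2l//.
    apply: (@le_trans _ _ (ell ^+ k * (C * ell ^- (2 * N)))).
      by rewrite ler_wpM2l ?exprn_ge0 ?(ltW l0)//; have /andP[] := wce_opt ell l1.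
    rewrite mulrCA ler_wpM2l ?(ltW C0)// ler_pdivrMr ?exprn_gt0//.
    rewrite mulrC ler_pdivlMr// -exprSr.
    by rewrite ler_weXn2l.
  have lim0 : (D + k`!%:R * C) * ell^-1 @[ell --> +oo] --> 0.
    by rewrite -[X in _ --> X](mulr0 (D + k`!%:R * C)); apply: cvgM;
      [exact: cvg_cst|exact: inv_cvg0_pinfty].
  apply/cvgrPdist_le => e e0; move/cvgr0Pnorm_le : lim0 => /(_ e e0).
  apply: filterS2 near1 => ell /close h1 /(le_trans (ler_norm _)); exact: le_trans.
have yx i : y ell i @[ell --> +oo] --> x i.
  exact: (nodes_cvg ab Lpos N0 x w xmono w0 gauss y v yab yasc moments).
have vw i : v ell i @[ell --> +oo] --> w i.
  exact: (weights_cvg ab Lpos N0 x w xmono w0 gauss y v yab yasc moments).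
exists XG, wG; split.
- split=> // X' w' [ascX exactX].
  (* A competing Gauss rule, viewed as a constant sequence, satisfies the convergence theorems and
     hence equals its limit. *)
  pose y' (_ : nat) i := val (X' ord0 i); pose v' (_ : nat) i := w' ord0 i.
  have y'ab n j : a <= y' n j <= b by exact: omega_itv.
  have y'asc : \forall n \near \oo, forall i j : 'I_N, (i <= j)%N -> y' n i <= y' n j.
    by apply: nearW => n; exact: ascX.
  have moments' k : (k < 2 * N)%N ->
      \sum_j v' n j * y' n j ^+ k @[n --> \oo] --> L (monomial k).
    move=> kN; rewrite -exactX; last by lia.
    exact: (@cvg_cst R (quad X' w' (monomial k))).
  have yx' i : y' n i @[n --> \oo] --> x i.
    exact: (nodes_cvg ab Lpos N0 x w xmono w0 gauss y' v' y'ab y'asc moments').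
  have vw' i : v' n i @[n --> \oo] --> w i.
    exact: (weights_cvg ab Lpos N0 x w xmono w0 gauss y' v' y'ab y'asc moments').
  have const_lim (c l : R) : c @[_ --> \oo] --> l -> c = l.
    by move=> cl; apply: (cvg_unique (@norm_hausdorff _ _) _ cl); exact: cvg_cst.
  split; apply/rowP => i; rewrite mxE; last by apply: const_lim; exact: (vw' i).
  by apply: val_inj; rewrite omegaK//; apply: const_lim; exact: (yx' i).
- apply: row_cvg => j; apply: omega_cvg; rewrite mxE omegaK//; exact: yx.
- apply: row_cvg => j; rewrite mxE.
  have u0 : y ell j ^+ 2 / (2 * ell ^+ 2) @[ell --> +oo] --> (0 : R).
    have -> : (fun ell => y ell j ^+ 2 / (2 * ell ^+ 2)) =
       (fun ell => y ell j * y ell j * 2^-1 * (ell^-1 * ell^-1)).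
      by apply/funext => ell; rewrite invfM !mulrA expr2 (expr2 ell) invfM mulrA.
    rewrite -[X in _ --> X](mulr0 (x j * x j * 2^-1)) -[X in _ * X](mulr0 0).
    apply: cvgM; last by apply: cvgM; exact: inv_cvg0_pinfty.
    by apply: cvgM; [apply: cvgM; exact: yx|exact: cvg_cst].
  (* The absorbed exponential is undone; as the nodes are bounded, its inverse tends to 1. *)
  have -> : (fun ell => wopt ell ord0 j) =
      (fun ell => v ell j * expR (y ell j ^+ 2 / (2 * ell ^+ 2))).
    by apply/funext => ell; rewrite /v -mulrA -expRD addNr expR0 mulr1.
  have e1 : expR (y ell j ^+ 2 / (2 * ell ^+ 2)) @[ell --> +oo] --> expR (0 : R).
    by apply: continuous_cvg u0; exact: continuous_expR.
  by rewrite -[X in _ --> X]mulr1 -[X in _ * X]expR0; apply: cvgM; [exact: vw|exact: e1].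
Qed.
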